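(* For any cartesian category $(\mathcal C,\times,1)$ there is an equivalence $$\mathrm{Fun}(\boldsymbol{\Delta}^{\mathrm{op}},\mathcal C)\;\simeq\;\mathrm{Fun}^{\otimes}\big((\mathcal D,\oplus,0),(\mathcal C,\times,1)\big)$$ between the category of simplicial objects $X$ in $\mathcal C$ and the category of monoidal functors $\overline X:\mathcal D\to\mathcal C$. The correspondence between $X$ and $\overline X$ is determined by the following properties. (a) The functors $X:\boldsymbol{\Delta}^{\mathrm{op}}\to\mathcal C$ and $\overline X:\mathcal D\to\mathcal C$ agree on the common subcategory $\boldsymbol{\Delta}_{\mathrm{act}}^{\mathrm{op}}\cong\underline{\boldsymbol{\Delta}}$. (b) Let $(\underline m\xrightarrow{a}\underline k)=\bigoplus_{i\in\underline k}(\underline{m}_i\xrightarrow{a_i}\underline 1)$ be the external sum decomposition of any object of $\mathcal D$ into connected objects, and for $i\in\underline k$ let $f_i:[m_i]\to[m_1]\vee\dots\vee[m_k]=[m]$ be the canonical inert map in $\boldsymbol{\Delta}$. Let $\varphi$ be the morphism in $\mathcal D$ from $\underline m\to\underline 1$ to $a:\underline m\to\underline k$ given by $\mathrm{id}:\underline m\to\underline m$ and the unique map $\underline k\to\underline 1$. Then $$\overline X(\varphi)=(X(f_1),\dots,X(f_k)):X_m\longrightarrow\prod_{i\in\underline k}X_{m_i},$$ and each $X(f_i)$ is the composite of $\overline X(\varphi)$ with the projection to $X_{m_i}$.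
   Context: A cartesian category is a category with finite products, regarded as monoidal under $\times$ with unit the terminal object $1$. $\boldsymbol{\Delta}$ is the category of nonempty finite ordinals $[k]=\{0,\dots,k\}$, $k\ge 0$, and monotone maps. A map $g:[m]\to[n]$ is active if $g(0)=0$, $g(m)=n$, and $f:[m]\to[n]$ is inert if $f(i+1)=f(i)+1$ for $0\le i\le m-1$. $\boldsymbol{\Delta}_{\mathrm{act}}$ is the subcategory of all objects and active maps; it is monoidal under amalgamated ordinal sum $[m]\vee[n]=[m+n]$ (gluing the top element of $[m]$ to the bottom element of $[n]$), with unit $[0]$. The canonical inert map $[m_i]\to[m_1]\vee\dots\vee[m_k]$ is the inclusion of the $i$th summand. $\underline{\boldsymbol{\Delta}}$ is the category of all finite ordinals $\underline n=\{1,\dots,n\}$, $n\ge 0$ (including the empty one), and monotone maps, monoidal under ordinal sum $+$ with unit $\underline 0$. There is a canonical monoidal isomorphism $(\underline{\boldsymbol{\Delta}},+,\underline 0)\cong(\boldsymbol{\Delta}_{\mathrm{act}}^{\mathrm{op}},\vee,[0])$, $\underline k\leftrightarrow[k]$, given by $\underline k\mapsto\mathrm{Hom}_{\underline{\boldsymbol{\Delta}}}(\underline k,\underline 2)\cong[k]$ and $[k]\mapsto\mathrm{Hom}_{\boldsymbol{\Delta}_{\mathrm{act}}}([k],[1])\cong\underline k$. $\mathcal D$ is the category whose objects are the arrows $\underline n\to\underline k$ of $\underline{\boldsymbol{\Delta}}$ and whose morphisms from $a:\underline m\to\underline h$ to $b:\underline n\to\underline k$ are pairs $(g,f)$ with $g:\underline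 m\to\underline n$ and $f:\underline k\to\underline h$ in $\underline{\boldsymbol{\Delta}}$ such that $a=f\circ b\circ g$ (so $\mathcal D^{\mathrm{op}}$ is the twisted arrow category of $\underline{\boldsymbol{\Delta}}$). $\mathcal D$ is monoidal under external sum $\oplus$: $(\underline n\to\underline k)\oplus(\underline n'\to\underline k')=(\underline n+\underline n'\to\underline k+\underline k')$, with neutral object $0=(\underline 0\to\underline 0)$. Objects of the form $\underline n\to\underline 1$ are called connected; $\underline{\boldsymbol{\Delta}}=\underline{\boldsymbol{\Delta}}_{/\underline 1}$ is embedded in $\mathcal D$ as the subcategory of connected objects, with morphisms $(g,\mathrm{id}_{\underline 1})$. Each object $a:\underline m\to\underline k$ is the external sum over $i\in\underline k$ of the connected objects $\underline m_i\to\underline 1$, where $\underline m_i$ is the (ordinal of the cardinality of the) fibre of $a$ over $i$. *)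

(* Defs.v *)
From mathcomp Require Import all_boot.
From Stdlib Require Import FunctionalExtensionality ProofIrrelevance.

Set Implicit Arguments.
Unset Strict Implicit.
Unset Printing Implicit Defensive.

Declare Scope cat_scope.
Delimit Scope cat_scope with cat.
Local Open Scope cat_scope.

Reserved Notation "g ∘ f" (at level 40, left associativity).
Reserved Notation "a ⊗ b" (at level 35, right associativity).
Reserved Notation "f ⊗₁ g" (at level 35, right associativity).

Record category : Type := Category {
  ob :> Type;
  hom : ob -> ob -> Type;
  idm : forall a, hom a a;
  ccomp : forall a b c, hom b c -> hom a b -> hom a c;
  ccompA : forall a b c d (h : hom c d) (g : hom b c) (f : hom a b),
    ccomp h (ccomp g f) = ccomp (ccomp h g) f;
  ccomp1m : forall a b (f : hom a b), ccomp (idm b) f = f;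
  ccompm1 : forall a b (f : hom a b), ccomp f (idm a) = f }.

Arguments hom {c} a b : rename.
Arguments idm {c} a : rename.
Arguments ccomp {c a b c0} g f : rename.
Notation "g ∘ f" := (ccomp g f) : cat_scope.

Definition op (C : category) : category :=
  @Category C (fun a b => @hom C b a) (fun a => idm a)
    (fun a b c g f => f ∘ g)
    (fun a b c d h g f => esym (ccompA f g h))
    (fun a b f => ccompm1 f) (fun a b f => ccomp1m f).

Definition eq_hom (C : category) (a b : C) (e : a = b) : hom a b :=
  match e in _ = c return hom a c with erefl => idm a end.

Record iso (C : category) (a b : C) : Type := Iso {
  fwd : hom a b;
  bwd : hom b a;
  fwdK : bwd ∘ fwd = idm a;
  bwdK : fwd ∘ bwd = idm b }.
Arguments iso {C} a b.

Record functor (C D : category) : Type := Functor {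
  fob :> C -> D;
  fmap : forall a b, hom a b -> hom (fob a) (fob b);
  fmap1 : forall a, fmap (idm a) = idm (fob a);
  fmapM : forall a b c (g : hom b c) (f : hom a b),
    fmap (g ∘ f) = fmap g ∘ fmap f }.
Arguments fmap {C D} f {a b} _ : rename.

Definition fid (C : category) : functor C C :=
  @Functor C C (fun a => a) (fun a b f => f)
    (fun a => erefl) (fun a b c g f => erefl).

Lemma fcomp_map1 (C D E : category) (G : functor D E) (F : functor C D) a :
  fmap G (fmap F (idm a)) = idm (G (F a)).
Proof. by rewrite !fmap1. Qed.

Lemma fcomp_mapM (C D E : category) (G : functor D E) (F : functor C D)
    a b c (g : hom b c) (f : hom a b) :
  fmap G (fmap F (g ∘ f)) = fmap G (fmap F g) ∘ fmap G (fmap F f).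
Proof. by rewrite !fmapM. Qed.

Definition fcomp (C D E : category) (G : functor D E) (F : functor C D) :
    functor C E :=
  @Functor C E (fun a => G (F a)) (fun a b f => fmap G (fmap F f))
    (fcomp_map1 G F) (fun a b c => @fcomp_mapM C D E G F a b c).

Definition fop (C D : category) (F : functor C D) : functor (op C) (op D) :=
  @Functor (op C) (op D) F (fun a b f => @fmap C D F b a f)
    (fun a => fmap1 F a) (fun a b c g f => fmapM F f g).

Record nattrans (C D : category) (F G : functor C D) : Type := Nattrans {
  nt :> forall a, hom (F a) (G a);
  ntP : forall a b (f : hom a b), nt b ∘ fmap F f = fmap G f ∘ nt a }.

Lemma nattrans_eq (C D : category) (F G : functor C D) (s t : nattrans F G) :
  (forall a, s a = t a) -> s = t.
Proof.
case: s t => [s sP] [t tP] /= st.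
have {st} e := functional_extensionality_dep _ _ st; subst t.
by rewrite (proof_irrelevance _ sP tP).
Qed.

Lemma nt_idP (C D : category) (F : functor C D) a b (f : hom a b) :
  idm (F b) ∘ fmap F f = fmap F f ∘ idm (F a).
Proof. by rewrite ccomp1m ccompm1. Qed.

Definition nt_id (C D : category) (F : functor C D) : nattrans F F :=
  Nattrans (@nt_idP C D F).

Lemma nt_compP (C D : category) (F G H : functor C D)
    (t : nattrans G H) (s : nattrans F G) a b (f : hom a b) :
  (t b ∘ s b) ∘ fmap F f = fmap H f ∘ (t a ∘ s a).
Proof. by rewrite -ccompA ntP ccompA ntP ccompA. Qed.

Definition nt_comp (C D : category) (F G H : functor C D)
    (t : nattrans G H) (s : nattrans F G) : nattrans F H :=
  Nattrans (nt_compP t s).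

Definition fun_cat (C D : category) : category.
Proof.
refine (@Category (functor C D) (@nattrans C D) (@nt_id C D)
  (fun F G H t s => nt_comp t s) _ _ _).
- by move=> F G H K u t s; apply: nattrans_eq => a; apply: ccompA.
- by move=> F G s; apply: nattrans_eq => a; apply: ccomp1m.
- by move=> F G s; apply: nattrans_eq => a; apply: ccompm1.
Defined.

Record equivalence (C D : category) : Type := Equivalence {
  eqv_to : functor C D;
  eqv_from : functor D C;
  eqv_unit : @iso (fun_cat C C) (fid C) (fcomp eqv_from eqv_to);
  eqv_counit : @iso (fun_cat D D) (fcomp eqv_to eqv_from) (fid D) }.

Record monoidal : Type := Monoidal {
  mcat :> category;
  munit : mcat;
  tens : mcat -> mcat -> mcat;
  tensm : forall a b c d : mcat,
    hom a b -> hom c d -> hom (tens a c) (tens b d);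
  tens1 : forall a b, tensm (idm a) (idm b) = idm (tens a b);
  tensM : forall a b c a' b' c' (g : hom b c) (f : hom a b)
    (g' : hom b' c') (f' : hom a' b'),
    tensm (g ∘ f) (g' ∘ f') = tensm g g' ∘ tensm f f';
  massoc : forall a b c, iso (tens (tens a b) c) (tens a (tens b c));
  massoc_nat : forall a b c a' b' c'
    (f : hom a a') (g : hom b b') (h : hom c c'),
    fwd (massoc a' b' c') ∘ tensm (tensm f g) h
      = tensm f (tensm g h) ∘ fwd (massoc a b c);
  mlunit : forall a, iso (tens munit a) a;
  mlunit_nat : forall a b (f : hom a b),
    fwd (mlunit b) ∘ tensm (idm munit) f = f ∘ fwd (mlunit a);
  mrunit : forall a, iso (tens a munit) a;
  mrunit_nat : forall a b (f : hom a b),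
    fwd (mrunit b) ∘ tensm f (idm munit) = f ∘ fwd (mrunit a);
  mpentagon : forall a b c d,
    fwd (massoc a b (tens c d)) ∘ fwd (massoc (tens a b) c d)
      = tensm (idm a) (fwd (massoc b c d)) ∘
        (fwd (massoc a (tens b c) d) ∘
         tensm (fwd (massoc a b c)) (idm d));
  mtriangle : forall a b,
    tensm (idm a) (fwd (mlunit b)) ∘ fwd (massoc a munit b)
      = tensm (fwd (mrunit a)) (idm b) }.

Arguments munit {m} : rename.
Arguments tens {m} a b : rename.
Arguments tensm {m a b c d} f g : rename.
Arguments massoc {m} a b c : rename.
Arguments mlunit {m} a : rename.
Arguments mrunit {m} a : rename.
Notation "a ⊗ b" := (tens a b) : cat_scope.
Notation "f ⊗₁ g" := (tensm f g) : cat_scope.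

Record monfunctor (M N : monoidal) : Type := Monfunctor {
  mfun :> functor M N;
  mmu : forall a b, iso (mfun a ⊗ mfun b) (mfun (a ⊗ b));
  meps : iso munit (mfun munit);
  mmu_nat : forall a b a' b' (f : hom a a') (g : hom b b'),
    fwd (mmu a' b') ∘ (fmap mfun f ⊗₁ fmap mfun g)
      = fmap mfun (f ⊗₁ g) ∘ fwd (mmu a b);
  mmuA : forall a b c,
    fmap mfun (fwd (massoc a b c)) ∘
      (fwd (mmu (a ⊗ b) c) ∘ (fwd (mmu a b) ⊗₁ idm (mfun c)))
    = fwd (mmu a (b ⊗ c)) ∘
      ((idm (mfun a) ⊗₁ fwd (mmu b c)) ∘
        fwd (massoc (mfun a) (mfun b) (mfun c)));
  mmu1l : forall a,
    fmap mfun (fwd (mlunit a)) ∘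
      (fwd (mmu munit a) ∘ (fwd meps ⊗₁ idm (mfun a)))
    = fwd (mlunit (mfun a));
  mmu1r : forall a,
    fmap mfun (fwd (mrunit a)) ∘
      (fwd (mmu a munit) ∘ (idm (mfun a) ⊗₁ fwd meps))
    = fwd (mrunit (mfun a)) }.

Record monnattrans (M N : monoidal) (F G : monfunctor M N) : Type :=
  Monnattrans {
    mnt :> nattrans F G;
    mnt_mu : forall a b,
      mnt (a ⊗ b) ∘ fwd (mmu F a b) = fwd (mmu G a b) ∘ (mnt a ⊗₁ mnt b);
    mnt_eps : mnt munit ∘ fwd (meps F) = fwd (meps G) }.

Lemma monnattrans_eq (M N : monoidal) (F G : monfunctor M N)
    (s t : monnattrans F G) : (forall a, s a = t a) -> s = t.
Proof.
case: s t => [s sm se] [t tm te] /= st.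
have {st} e := nattrans_eq st; subst t.
by rewrite (proof_irrelevance _ sm tm) (proof_irrelevance _ se te).
Qed.

Definition mnt_id (M N : monoidal) (F : monfunctor M N) : monnattrans F F.
Proof.
apply: (@Monnattrans _ _ _ _ (nt_id F)) => [a b|] /=.
- by rewrite tens1 ccomp1m ccompm1.
- by rewrite ccomp1m.
Defined.

Definition mnt_comp (M N : monoidal) (F G H : monfunctor M N)
  (t : monnattrans G H) (s : monnattrans F G) : monnattrans F H.
Proof.
apply: (@Monnattrans _ _ _ _ (nt_comp t s)) => [a b|] /=.
- by rewrite tensM ccompA -mnt_mu -!ccompA mnt_mu.
- by rewrite -ccompA !mnt_eps.
Defined.

Definition monfun_cat (M N : monoidal) : category.
Proof.
refine (@Category (monfunctor M N) (@monnattrans M N) (@mnt_id M N)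
  (fun F G H t s => mnt_comp t s) _ _ _).
- by move=> F G H K u t s; apply: monnattrans_eq => a; apply: ccompA.
- by move=> F G s; apply: monnattrans_eq => a; apply: ccomp1m.
- by move=> F G s; apply: monnattrans_eq => a; apply: ccompm1.
Defined.

Fixpoint bigtens (M : monoidal) (k : nat) : ('I_k -> M) -> M :=
  match k with
  | 0 => fun _ => munit
  | k'.+1 => fun x => x ord0 ⊗ bigtens (fun i => x (lift ord0 i))
  end.

(* F (x_1 ⊗ ... ⊗ x_k) -> F x_1 ⊗ ... ⊗ F x_k, built from the inverses of the
   structure isomorphisms of F. *)
Fixpoint mdecomp (M N : monoidal) (F : monfunctor M N) (k : nat) :
    forall x : 'I_k -> M, hom (F (bigtens x)) (bigtens (fun i => F (x i))) :=
  match k with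
  | 0 => fun _ => bwd (meps F)
  | k'.+1 => fun x =>
      (idm _ ⊗₁ mdecomp F (fun i => x (lift ord0 i))) ∘ bwd (mmu F _ _)
  end.

Record cartesian : Type := Cartesian {
  ccat :> category;
  cterm : ccat;
  cbang : forall a, hom a cterm;
  cbangP : forall a (f : hom a cterm), f = cbang a;
  cprod : ccat -> ccat -> ccat;
  cfst : forall a b, hom (cprod a b) a;
  csnd : forall a b, hom (cprod a b) b;
  cpair : forall c a b, hom c a -> hom c b -> hom c (cprod a b);
  cfstP : forall c a b (f : hom c a) (g : hom c b), cfst a b ∘ cpair f g = f;
  csndP : forall c a b (f : hom c a) (g : hom c b), csnd a b ∘ cpair f g = g;
  cpairP : forall c a b (h : hom c (cprod a b)),
    h = cpair (cfst a b ∘ h) (csnd a b ∘ h) }.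

Arguments cterm {c} : rename.
Arguments cbang {c} a : rename.
Arguments cprod {c} a b : rename.
Arguments cfst {c} a b : rename.
Arguments csnd {c} a b : rename.
Arguments cpair {c c0 a b} f g : rename.

Section CartesianMonoidal.
Variable C : cartesian.
Implicit Types a b c d : C.

Lemma cpair_ext c a b (h h' : hom c (cprod a b)) :
  cfst a b ∘ h = cfst a b ∘ h' -> csnd a b ∘ h = csnd a b ∘ h' -> h = h'.
Proof. by move=> e1 e2; rewrite (cpairP h) (cpairP h') e1 e2. Qed.

Lemma cbang_ext a (h h' : hom a (@cterm C)) : h = h'.
Proof. by rewrite (cbangP h) (cbangP h'). Qed.

Lemma cfstA d c a b (f : hom c a) (g : hom c b) (h : hom d c) :
  cfst a b ∘ (cpair f g ∘ h) = f ∘ h.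
Proof. by rewrite ccompA cfstP. Qed.

Lemma csndA d c a b (f : hom c a) (g : hom c b) (h : hom d c) :
  csnd a b ∘ (cpair f g ∘ h) = g ∘ h.
Proof. by rewrite ccompA csndP. Qed.

Definition cprodm a b c d (f : hom a b) (g : hom c d) :
    hom (cprod a c) (cprod b d) :=
  cpair (f ∘ cfst a c) (g ∘ csnd a c).

Let simp := (cfstA, csndA, cfstP, csndP, ccomp1m, ccompm1).

Ltac cart := rewrite /cprodm; repeat (apply: cpair_ext); try apply: cbang_ext;
  do ?progress rewrite -?ccompA ?simp.

Definition cassoc a b c :
  iso (cprod (cprod a b) c) (cprod a (cprod b c)).
Proof.
refine (@Iso C _ _
  (cpair (cfst a b ∘ cfst _ c) (cpair (csnd a b ∘ cfst _ c) (csnd _ c)))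
  (cpair (cpair (cfst a _) (cfst b c ∘ csnd a _)) (csnd b c ∘ csnd a _))
  _ _); by cart.
Defined.

Definition clunit a : iso (cprod cterm a) a.
Proof.
by refine (@Iso C _ _ (csnd _ _) (cpair (cbang a) (idm a)) _ _); cart.
Defined.

Definition crunit a : iso (cprod a cterm) a.
Proof.
by refine (@Iso C _ _ (cfst _ _) (cpair (idm a) (cbang a)) _ _); cart.
Defined.

Definition cart_monoidal : monoidal.
Proof.
refine (@Monoidal C cterm cprod cprodm _ _ cassoc _ clunit _ crunit _ _ _);
  by move=> *; cart.
Defined.

End CartesianMonoidal.

Definition ord_case (k : nat) (P : 'I_k.+1 -> Type) (P0 : P ord0)
    (PS : forall j : 'I_k, P (lift ord0 j)) (i : 'I_k.+1) : P i :=
  match unliftP ord0 i with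
  | UnliftSome j e => ecast i (P i) (esym e) (PS j)
  | UnliftNone e => ecast i (P i) (esym e) P0
  end.

(* The product of x_1, ..., x_k is bigtens x in the cartesian monoidal category;
   for k = 0 it is the terminal object. *)
Fixpoint bigproj (C : cartesian) (k : nat) :
    forall (x : 'I_k -> cart_monoidal C) (i : 'I_k), hom (bigtens x) (x i) :=
  match k with
  | 0 => fun x i => False_rect _ (notF (valP i))
  | k'.+1 => fun x =>
      @ord_case k' (fun i => hom (bigtens x) (x i)) (cfst _ _)
        (fun j => bigproj (fun j => x (lift ord0 j)) j ∘ csnd _ _)
  end.

Fixpoint bigtuple (C : cartesian) (c : cart_monoidal C) (k : nat) :
    forall x : 'I_k -> cart_monoidal C,
      (forall i, hom c (x i)) -> hom c (bigtens x) :=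
  match k with
  | 0 => fun _ _ => cbang c
  | k'.+1 => fun x h => cpair (h ord0) (bigtuple (fun i => h (lift ord0 i)))
  end.

Lemma ord_case0 k (P : 'I_k.+1 -> Type) (P0 : P ord0)
    (PS : forall j : 'I_k, P (lift ord0 j)) : ord_case P0 PS ord0 = P0.
Proof.
by rewrite /ord_case; case: unliftP => [j //|e]; rewrite (eq_irrelevance e erefl).
Qed.

Lemma ord_caseS k (P : 'I_k.+1 -> Type) (P0 : P ord0)
    (PS : forall j : 'I_k, P (lift ord0 j)) j :
  ord_case P0 PS (lift ord0 j) = PS j.
Proof.
rewrite /ord_case; case: unliftP => [l e|//].
have jl := lift_inj e; subst l.
by rewrite (eq_irrelevance e erefl).
Qed.

Lemma bigprojP (C : cartesian) k (x : 'I_k -> cart_monoidal C)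
    (c : cart_monoidal C) (h : forall i, hom c (x i)) i :
  bigproj x i ∘ bigtuple h = h i.
Proof.
elim: k x h i => [|k IH] x h i; first by case: i.
case: (unliftP ord0 i) => [j|] -> /=.
- by rewrite ord_caseS -ccompA csndP; apply: IH.
- by rewrite ord_case0; apply: cfstP.
Qed.

Lemma bigtupleP (C : cartesian) k (x : 'I_k -> cart_monoidal C)
    (c : cart_monoidal C) (h : hom c (bigtens x)) :
  h = bigtuple (fun i => bigproj x i ∘ h).
Proof.
elim: k x h => [|k IH] x h /=; first exact: cbangP.
rewrite [LHS](@cpairP C) ord_case0; congr cpair.
rewrite [LHS]IH; congr bigtuple; apply: functional_extensionality_dep => j.
by rewrite ord_caseS ccompA.
Qed.

(* 'I_n plays the role of the ordinal {1, ..., n}, and 'I_n.+1 that of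
   [n] = {0, ..., n}. *)
Record omap (m n : nat) : Type := Omap {
  ofun :> 'I_m -> 'I_n;
  omono : {homo ofun : i j / (i <= j)%N} }.

Lemma omapP m n (f g : omap m n) : f =1 g -> f = g.
Proof.
case: f g => [f fm] [g gm] /= fg.
have {fg} e := functional_extensionality _ _ fg; subst g.
by rewrite (proof_irrelevance _ fm gm).
Qed.

Definition oid n : omap n n := @Omap n n (fun i => i) (fun i j ij => ij).

Definition ocomp m n p (g : omap n p) (f : omap m n) : omap m p :=
  @Omap m p (fun i => g (f i)) (fun i j ij => omono g (omono f ij)).

Lemma ocompE m n p (g : omap n p) (f : omap m n) i : ocomp g f i = g (f i).
Proof. by []. Qed.

Definition ocast m n (e : m = n) : omap m n :=
  @Omap m n (cast_ord e) (fun i j ij => ij).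

Definition oconst n : omap n 1 := @Omap n 1 (fun _ => ord0) (fun _ _ _ => isT).

Lemma eq_to_1 m (f g : omap m 1) : f = g.
Proof. by apply: omapP => i; rewrite (ord1 (f i)) (ord1 (g i)). Qed.

Section Osum.
Variables (m n m' n' : nat) (f : omap m n) (f' : omap m' n').

Definition osum_fun (i : 'I_(m + m')) : 'I_(n + n') :=
  match split i with
  | inl j => lshift n' (f j)
  | inr j => rshift n (f' j)
  end.

Lemma osum_mono : {homo osum_fun : i j / (i <= j)%N}.
Proof.
move=> i j; rewrite /osum_fun.
case: splitP => i' ->; case: splitP => j' -> /=.
- exact: omono.
- by move=> _; rewrite (leq_trans (ltnW (ltn_ord _))) ?leq_addr.
- by move=> h; have := leq_trans (ltn_ord j') (leq_trans (leq_addr i' m) h);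
     rewrite ltnn.
- by rewrite !leq_add2l; apply: omono.
Qed.

Definition osum : omap (m + m') (n + n') := Omap osum_mono.

Lemma osum_lshift j : osum (lshift m' j) = lshift n' (f j).
Proof. by rewrite /= /osum_fun (unsplitK (inl j)). Qed.

Lemma osum_rshift j : osum (rshift m j) = rshift n (f' j).
Proof. by rewrite /= /osum_fun (unsplitK (inr j)). Qed.
End Osum.

Definition osumE := (osum_lshift, osum_rshift).

Definition Delta : category.
Proof.
refine (@Category nat (fun m n => omap m.+1 n.+1) (fun n => oid n.+1)
  (fun m n p g f => ocomp g f) _ _ _); by move=> *; apply: omapP.
Defined.

Definition UDelta : category.
Proof.
refine (@Category nat omap oid ocomp _ _ _); by move=> *; apply: omapP.
Defined.

Definition active m n (g : omap m.+1 n.+1) : Prop :=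
  g ord0 = ord0 /\ g ord_max = ord_max.

Definition inert m n (f : omap m.+1 n.+1) : Prop :=
  forall i j : 'I_m.+1, j = i.+1 :> nat -> f j = (f i).+1 :> nat.

Record actmap (m n : nat) : Type := Actmap {
  actm :> omap m.+1 n.+1;
  actmP : active actm }.

Lemma actmapP m n (f g : actmap m n) : f =1 g -> f = g.
Proof.
case: f g => [f fm] [g gm] /= fg.
have {fg} e := omapP fg; subst g.
by rewrite (proof_irrelevance _ fm gm).
Qed.

Definition actid n : actmap n n :=
  @Actmap n n (oid n.+1) (conj erefl erefl).

Lemma actcompP m n p (g : actmap n p) (f : actmap m n) : active (ocomp g f).
Proof.
by case: g f => [g [g0 g1]] [f [f0 f1]]; split; rewrite /= ?f0 ?f1.
Qed.

Definition DeltaAct : category.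
Proof.
refine (@Category nat actmap actid
  (fun m n p g f => Actmap (actcompP g f)) _ _ _); by move=> *; apply: actmapP.
Defined.

Definition act_incl : functor DeltaAct Delta :=
  @Functor DeltaAct Delta (fun n => n) (fun m n f => actm f)
    (fun n => erefl) (fun m n p g f => erefl).

Lemma card_lt_ord n c : c <= n -> #|[set i : 'I_n | (i < c)%N]| = c.
Proof.
move=> cn; rewrite -sum1dep_card (big_ord_narrow cn) /=.
by rewrite sum1_card card_ord.
Qed.

Lemma omap_ltE m k (a : omap m k) (c : nat) (i : 'I_m) :
  (a i < c)%N = (i < #|[set x | (a x < c)%N]|)%N.
Proof.
have [ac|ca] := ltnP (a i) c; apply/esym.
- rewrite -(card_lt_ord (ltn_ord i)); apply/subset_leq_card/subsetP => x.
  by rewrite !inE ltnS => xi; apply: leq_ltn_trans ac; apply: omono.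
- apply: negbTE; rewrite -leqNgt -[leqRHS](card_lt_ord (ltnW (ltn_ord i))).
  apply/subset_leq_card/subsetP => x; rewrite !inE => xc.
  by rewrite ltnNge; apply: contraL xc => ix; rewrite -leqNgt (leq_trans ca)
    ?omono.
Qed.

(* Hom(n, 2) is identified with [n] by sending h to the number of elements
   that h maps to the first element of 2. The other identification, by the
   number of elements mapped to the second one, would yield an isomorphism
   that reverses the monoidal structure. *)
Lemma cut_subproof n (h : omap n 2) : #|[set i | h i == ord0]| < n.+1.
Proof. by rewrite ltnS -[leqRHS]card_ord max_card. Qed.

Definition cut n (h : omap n 2) : 'I_n.+1 := Ordinal (cut_subproof h).

Definition of_cut_fun n (c : 'I_n.+1) (i : 'I_n) : 'I_2 :=
  if (i < c)%N then ord0 else ord_max.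

Lemma of_cut_mono n (c : 'I_n.+1) : {homo of_cut_fun c : i j / (i <= j)%N}.
Proof.
move=> i j ij; rewrite /of_cut_fun.
by case: (ltnP j c) => [/(leq_ltn_trans ij) -> //|_]; case: ifP.
Qed.

Definition of_cut n (c : 'I_n.+1) : omap n 2 := Omap (of_cut_mono c).

Lemma of_cut_eq0 n (c : 'I_n.+1) i : (of_cut c i == ord0) = (i < c)%N.
Proof. by rewrite /= /of_cut_fun; case: ifP. Qed.

Lemma of_cutK n : cancel (@of_cut n) (@cut n).
Proof.
move=> c; apply: val_inj => /=; rewrite -[RHS](@card_lt_ord n) -1?ltnS //.
by apply: eq_card => i; rewrite !inE of_cut_eq0.
Qed.

Lemma cutK n : cancel (@cut n) (@of_cut n).
Proof.
have lt2 (j : 'I_2) : (j < 1)%N = (j == ord0) by case: j => [[|[]]].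
move=> h; apply: omapP => i.
suff: (of_cut (cut h) i == ord0) = (h i == ord0).
  case: (of_cut _ i) (h i) => [[|[|//]] p] [[|[|//]] q] //= _; exact: val_inj.
rewrite of_cut_eq0 -lt2 omap_ltE /=; congr (_ < _)%N.
by apply: eq_card => x; rewrite !inE lt2.
Qed.

(* Precomposition with f : m -> n, seen as a map [n] -> [m]. *)
Definition precomp_fun m n (f : omap m n) (c : 'I_n.+1) : 'I_m.+1 :=
  cut (ocomp (of_cut c) f).

Lemma precomp_mono m n (f : omap m n) :
  {homo precomp_fun f : c d / (c <= d)%N}.
Proof.
move=> c d cd; apply/subset_leq_card/subsetP => x; rewrite !inE.
by rewrite /= -/(of_cut c _) -/(of_cut d _) !of_cut_eq0 => /leq_trans; apply.
Qed.

Lemma precomp_active m n (f : omap m n) : active (Omap (precomp_mono f)).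
Proof.
split; apply: val_inj => /=.
- by apply: eq_card0 => i; rewrite !inE.
- rewrite -[RHS]card_ord -cardsT; apply: eq_card => i; rewrite !inE.
  by rewrite /= /of_cut_fun ltn_ord.
Qed.

Definition udelta_act : functor UDelta (op DeltaAct).
Proof.
refine (@Functor UDelta (op DeltaAct) (fun n => n)
  (fun m n f => Actmap (precomp_active f)) _ _).
- move=> n; apply: actmapP => c; rewrite /= /precomp_fun -[RHS]of_cutK.
  by congr cut; apply: omapP.
- move=> m n p g f; apply: actmapP => c; rewrite /= /precomp_fun cutK.
  by congr cut; apply: omapP.
Defined.

Lemma udelta_act_inj m n : injective (@fmap _ _ udelta_act m n).
Proof.
move=> f g fg; apply: omapP => x; apply: val_inj.
have cardE c : c < n.+1 ->
    #|[set i | (f i < c)%N]| = #|[set i | (g i < c)%N]|.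
  move=> cn; have h := congr1 (fun h : actmap n m => val (h (Ordinal cn))) fg.
  have E (u : omap m n) : val (precomp_fun u (Ordinal cn))
      = #|[set i | (u i < c)%N]|.
    by apply: eq_card => i; rewrite !inE; apply: (of_cut_eq0 (Ordinal cn)).
  exact: (etrans (esym (E f)) (etrans h (E g))).
have ltE c : c < n.+1 -> (f x < c)%N = (g x < c)%N.
  by move=> cn; rewrite !omap_ltE cardE.
have := ltE (f x).+1 (ltn_ord _); have := ltE (g x).+1 (ltn_ord _).
by rewrite !ltnS !leqnn => fg' gf; apply/eqP; rewrite eqn_leq fg' -gf.
Qed.

Lemma udelta_act_surj m n (p : actmap n m) :
  exists f : omap m n, fmap udelta_act f = p.
Proof.
case: p => p [p0 pn].
pose N (i : nat) := #|[set c | (p c < i.+1)%N]|.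
have N1 (i : 'I_m) : 0 < N i by rewrite /N -(omap_ltE p i.+1 ord0) p0.
have Nn (i : 'I_m) : N i <= n.
  rewrite leqNgt /N -(omap_ltE p i.+1 ord_max) pn /= ltnS -ltnNge.
  exact: ltn_ord.
have f_lt (i : 'I_m) : (N i).-1 < n by rewrite prednK.
have f_mono : {homo (fun i => Ordinal (f_lt i)) : i j / (i <= j)%N}.
  move=> i j ij /=; rewrite -ltnS !prednK //.
  by apply/subset_leq_card/subsetP => c; rewrite !inE !ltnS => /leq_trans; apply.
exists (Omap f_mono); apply: actmapP => c; apply: val_inj => /=.
rewrite -[RHS](@card_lt_ord m) -1?ltnS //; apply: eq_card => i.
rewrite !inE of_cut_eq0 /=.
by rewrite -[(_ < c)%N]ltnS prednK // ltnS leqNgt /N -omap_ltE ltnS -ltnNge.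
Qed.

Record dob : Type := Dob { dsrc : nat; dtgt : nat; darr : omap dsrc dtgt }.

Record dhom (a b : dob) : Type := Dhom {
  dfst : omap (dsrc a) (dsrc b);
  dsnd : omap (dtgt b) (dtgt a);
  dhomP : darr a = ocomp dsnd (ocomp (darr b) dfst) }.

Lemma dhom_eq a b (s t : dhom a b) :
  dfst s =1 dfst t -> dsnd s =1 dsnd t -> s = t.
Proof.
case: s t => [s s' sP] [t t' tP] /= st st'.
have {st} e := omapP st; have {st'} e' := omapP st'; subst t t'.
by rewrite (proof_irrelevance _ sP tP).
Qed.

Definition did a : dhom a a.
Proof. by apply: (@Dhom a a (oid _) (oid _)); apply: omapP. Defined.

Lemma dcompP a b c (t : dhom b c) (s : dhom a b) :
  darr a = ocomp (ocomp (dsnd s) (dsnd t))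
             (ocomp (darr c) (ocomp (dfst t) (dfst s))).
Proof. by rewrite (dhomP s) (dhomP t); apply: omapP. Qed.

Definition dcomp a b c (t : dhom b c) (s : dhom a b) : dhom a c :=
  Dhom (dcompP t s).

Definition Dcat : category.
Proof.
refine (@Category dob dhom did dcomp _ _ _); by move=> *; apply: dhom_eq.
Defined.

Definition dsum (a b : dob) : dob := Dob (osum (darr a) (darr b)).

Lemma osum_ext m m' n (f g : omap (m + m') n) :
  (forall i, f (lshift m' i) = g (lshift m' i)) ->
  (forall i, f (rshift m i) = g (rshift m i)) -> f = g.
Proof. by move=> fl fr; apply: omapP => i; case: (split_ordP i) => j ->. Qed.

Lemma osum_comp m n p m' n' p' (g : omap n p) (f : omap m n)
    (g' : omap n' p') (f' : omap m' n') :
  osum (ocomp g f) (ocomp g' f') = ocomp (osum g g') (osum f f').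
Proof.
by apply: osum_ext => i; rewrite ocompE !osumE.
Qed.

Lemma ocast_eq m n (e e' : m = n) : ocast e = ocast e'.
Proof. by rewrite (eq_irrelevance e e'). Qed.

Lemma ocast_id m (e : m = m) : ocast e = oid m.
Proof. by apply: omapP => i; apply: val_inj. Qed.

Lemma ocast_comp m n p (e : m = n) (e' : n = p) :
  ocomp (ocast e') (ocast e) = ocast (etrans e e').
Proof. by apply: omapP => i; apply: val_inj. Qed.

Lemma osum_cast m n m' n' (e : m = n) (e' : m' = n') :
  osum (ocast e) (ocast e') = ocast (f_equal2 addn e e').
Proof.
by subst n n'; apply: osum_ext => i; rewrite osumE; apply: val_inj.
Qed.

Lemma osum_id m n : osum (oid m) (oid n) = oid (m + n).
Proof. by apply: osum_ext => i; rewrite osumE. Qed.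

Lemma ocompA m n p q (h : omap p q) (g : omap n p) (f : omap m n) :
  ocomp h (ocomp g f) = ocomp (ocomp h g) f.
Proof. exact: omapP. Qed.

Lemma osum_assoc m n m' n' m'' n''
    (f : omap m n) (g : omap m' n') (h : omap m'' n'') :
  ocomp (ocast (esym (addnA _ _ _))) (osum (osum f g) h)
    = ocomp (osum f (osum g h)) (ocast (esym (addnA _ _ _))).
Proof.
have El i : ocast (esym (addnA m m' m'')) (lshift m'' (lshift m' i))
              = lshift (m' + m'') i by apply: val_inj.
have Em i : ocast (esym (addnA m m' m'')) (lshift m'' (rshift m i))
              = rshift m (lshift m'' i) by apply: val_inj.
have Er i : ocast (esym (addnA m m' m'')) (rshift (m + m') i)
              = rshift m (rshift m' i) by apply: val_inj => /=; rewrite addnA.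
apply: osum_ext => i; last first.
  by rewrite !ocompE Er !osumE; apply: val_inj => /=; rewrite addnA.
case: (split_ordP i) => j ->.
- by rewrite !ocompE El !osumE; apply: val_inj.
- by rewrite !ocompE Em !osumE; apply: val_inj.
Qed.

Lemma osum_0l m n (f : omap m n) :
  ocomp (ocast (add0n n)) (osum (oid 0) f) = ocomp f (ocast (add0n m)).
Proof.
apply: osum_ext => [[]//|i].
rewrite !ocompE osumE.
by apply: val_inj => /=; congr (val (f _)); apply: val_inj.
Qed.

Lemma osum_0r m n (f : omap m n) :
  ocomp (ocast (addn0 n)) (osum f (oid 0)) = ocomp f (ocast (addn0 m)).
Proof.
apply: osum_ext => [i|[]//].
rewrite !ocompE osumE.
by apply: val_inj => /=; congr (val (f _)); apply: val_inj.
Qed.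

Section Diso.
Variables (a b : dob) (es : dsrc a = dsrc b) (et : dtgt a = dtgt b).
Hypothesis sq : ocomp (ocast et) (darr a) = ocomp (darr b) (ocast es).

Definition diso_fwd : dhom a b.
Proof.
apply: (@Dhom a b (ocast es) (ocast (esym et))).
by rewrite -sq ocompA ocast_comp ocast_id; apply: omapP.
Defined.

Definition diso_bwd : dhom b a.
Proof.
apply: (@Dhom b a (ocast (esym es)) (ocast et)).
by rewrite ocompA sq -ocompA ocast_comp ocast_id; apply: omapP.
Defined.

Definition diso : @iso Dcat a b.
Proof.
refine (@Iso Dcat a b diso_fwd diso_bwd _ _);
  by apply: dhom_eq => i; apply: val_inj.
Defined.
End Diso.

Definition dsumm a b c d (s : dhom a b) (t : dhom c d) :
  dhom (dsum a c) (dsum b d).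
Proof.
apply: (@Dhom (dsum a c) (dsum b d)
  (osum (dfst s) (dfst t)) (osum (dsnd s) (dsnd t))).
by rewrite /= (dhomP s) (dhomP t) !osum_comp.
Defined.

Definition dzero : dob := Dob (oid 0).

Definition dassoc a b c :
    @iso Dcat (dsum (dsum a b) c) (dsum a (dsum b c)) :=
  @diso (dsum (dsum a b) c) (dsum a (dsum b c)) _ _ (osum_assoc _ _ _).

Definition dlunit a : @iso Dcat (dsum dzero a) a :=
  @diso (dsum dzero a) a _ _ (osum_0l (darr a)).

Definition drunit a : @iso Dcat (dsum a dzero) a :=
  @diso (dsum a dzero) a _ _ (osum_0r (darr a)).

Lemma dhom_ext a b (s t : dhom a b) :
  dfst s = dfst t -> dsnd s = dsnd t -> s = t.
Proof. by move=> e e'; apply: dhom_eq => i; rewrite ?e ?e'. Qed.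

Lemma ocast_flip m n m' n' (e : m = m') (e' : n = n') (u : omap m n)
    (v : omap m' n') : ocomp (ocast e') u = ocomp v (ocast e) ->
  ocomp u (ocast (esym e)) = ocomp (ocast (esym e')) v.
Proof.
subst m' n'; rewrite !ocast_id => h.
have -> : ocomp u (oid m) = ocomp (oid n) u by apply: omapP.
by rewrite h; apply: omapP.
Qed.

Definition Dmon : monoidal.
Proof.
refine (@Monoidal Dcat dzero dsum dsumm _ _ dassoc _ dlunit _ drunit _ _ _).
- by move=> a b; apply: dhom_ext; apply: osum_id.
- by move=> a b c a' b' c' g f g' f'; apply: dhom_ext; apply: osum_comp.
- move=> a b c a' b' c' f g h; apply: dhom_ext => /=; first exact: osum_assoc.
  by apply: ocast_flip; apply: osum_assoc.
- move=> a b f; apply: dhom_ext => /=; first exact: osum_0l.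
  by apply: ocast_flip; apply: osum_0l.
- move=> a b f; apply: dhom_ext => /=; first exact: osum_0r.
  by apply: ocast_flip; apply: osum_0r.
- move=> a b c d; apply: dhom_ext => /=;
    rewrite -!(ocast_id (erefl _)) !osum_cast !ocast_comp; exact: ocast_eq.
- move=> a b; apply: dhom_ext => /=;
    rewrite -!(ocast_id (erefl _)) !osum_cast ?ocast_comp; exact: ocast_eq.
Defined.

Definition conn (n : nat) : dob := Dob (oconst n).

Definition conn_hom m n (g : omap m n) : dhom (conn m) (conn n) :=
  @Dhom (conn m) (conn n) g (oid 1) (eq_to_1 _ _).

Definition ud_incl : functor UDelta Dcat.
Proof.
by refine (@Functor UDelta Dcat conn conn_hom _ _) => *; apply: dhom_ext.
Defined.

Definition fibre (a : dob) (i : 'I_(dtgt a)) : nat :=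
  #|[set x | darr a x == i]|.

Arguments fibre : clear implicits.

Lemma sum_fibre a : \sum_i fibre a i = dsrc a.
Proof.
rewrite -[RHS]card_ord -sum1_card (partition_big (darr a) xpredT) //=.
by apply: eq_bigr => i _; rewrite sum1dep_card.
Qed.

Lemma omap_fibre_eq m k (f g : omap m k) :
  (forall i : 'I_k, #|[set x | f x == i]| = #|[set x | g x == i]|) -> f = g.
Proof.
move=> fg; apply: omapP => x; apply: val_inj.
have lt_card (h : omap m k) c : #|[set x | (h x < c)%N]|
    = \sum_(i < k | (i < c)%N) #|[set x | h x == i]|.
  rewrite -sum1dep_card (partition_big h (fun i : 'I_k => (i < c)%N)) //=.
  apply: eq_bigr => i ic; rewrite sum1dep_card; apply: eq_card => y.
  by rewrite !inE; case: eqP => [->|]; rewrite ?ic ?andbF.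
have ltE c : (f x < c)%N = (g x < c)%N.
  by rewrite !omap_ltE !lt_card; congr (_ < _)%N; apply: eq_bigr.
have := ltE (g x).+1; have := ltE (f x).+1; rewrite !ltnS !leqnn => gf fg'.
by apply/eqP; rewrite eqn_leq fg' -gf.
Qed.

Lemma dob_fibre_eq (a b : dob) (e : dtgt a = dtgt b) :
  (forall i, fibre a i = fibre b (cast_ord e i)) -> a = b.
Proof.
case: a b e => [m k f] [n l g] /= e; subst l => fg.
have {}fg (i : 'I_k) : fibre (Dob f) i = fibre (Dob g) i.
  by rewrite fg; congr fibre; apply: val_inj.
have e : m = n.
  apply: etrans (esym (sum_fibre (Dob f))) (etrans _ (sum_fibre (Dob g))).
  by apply: eq_bigr => i _; apply: fg.
by subst n; congr Dob; apply: omap_fibre_eq => i; apply: fg.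
Qed.

Definition ext_sum k (p : 'I_k -> nat) : Dmon :=
  @bigtens Dmon k (fun i => conn (p i)).

Lemma dtgt_ext_sum k (p : 'I_k -> nat) : dtgt (ext_sum p) = k.
Proof. by elim: k p => [//|k IH] p; rewrite /= [dtgt _]IH. Qed.

Lemma fibre_dsuml a b i : fibre (dsum a b) (lshift _ i) = fibre a i.
Proof.
rewrite /fibre -!sum1dep_card big_split_ord /= [X in _ + X]big_pred0 ?addn0.
  by apply: eq_bigl => x; rewrite -[osum_fun _ _ _]/(osum _ _ _) osumE eq_lshift.
by move=> x; rewrite -[osum_fun _ _ _]/(osum _ _ _) osumE eq_rlshift.
Qed.

Lemma fibre_dsumr a b i : fibre (dsum a b) (rshift _ i) = fibre b i.
Proof.
rewrite /fibre -!sum1dep_card big_split_ord /= [X in X + _]big_pred0 ?add0n.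
  by apply: eq_bigl => x; rewrite -[osum_fun _ _ _]/(osum _ _ _) osumE eq_rshift.
by move=> x; rewrite -[osum_fun _ _ _]/(osum _ _ _) osumE eq_lrshift.
Qed.

Lemma fibre_conn n i : fibre (conn n) i = n.
Proof.
rewrite -[RHS]card_ord /fibre; apply: eq_card => x.
by rewrite !inE /= (ord1 i) eqxx.
Qed.

Lemma fibre_ext_sum k (p : 'I_k -> nat) i :
  fibre (ext_sum p) (cast_ord (esym (dtgt_ext_sum p)) i) = p i.
Proof.
elim: k p i => [|k IH] p i; first by case: i.
case: (unliftP ord0 i) => [j|] ->.
- rewrite -(IH (fun j => p (lift ord0 j))) -[RHS](@fibre_dsumr (conn (p ord0))).
  by congr (fibre _ _); apply: val_inj.
- rewrite -[RHS](@fibre_conn _ ord0) -[RHS](@fibre_dsuml _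
    (ext_sum (fun j => p (lift ord0 j)))).
  by congr (fibre _ _); apply: val_inj.
Qed.

Lemma ext_sum_decomp (a : Dmon) : a = ext_sum (fibre a).
Proof.
apply: (@dob_fibre_eq a _ (esym (dtgt_ext_sum _))) => i.
by rewrite fibre_ext_sum.
Qed.

(* The amalgamated ordinal sum of [p_1], ..., [p_k] is [p_1 + ... + p_k], and
   its i-th summand starts at p_1 + ... + p_{i-1}. *)
Section VeeIncl.
Variables (k : nat) (p : 'I_k -> nat) (i : 'I_k).

Definition vee_incl_val (j : nat) : nat := \sum_(l < k | (l < i)%N) p l + j.

Lemma vee_incl_lt (j : 'I_(p i).+1) : vee_incl_val j < (\sum_l p l).+1.
Proof.
rewrite ltnS (bigID (fun l : 'I_k => (l < i)%N)) /= leq_add2l.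
by rewrite (bigD1 i) ?ltnn //= (leq_trans _ (leq_addr _ _)) // -ltnS.
Qed.

Definition vee_incl : omap (p i).+1 (\sum_l p l).+1.
Proof.
apply: (@Omap _ _ (fun j => Ordinal (vee_incl_lt j))) => x y /=.
by rewrite leq_add2l.
Defined.

Lemma vee_incl_inert : inert vee_incl.
Proof. by move=> x y /= ->; rewrite /vee_incl_val addnS. Qed.
End VeeIncl.

Definition inert_incl (a : dob) (i : 'I_(dtgt a)) :
    @hom Delta (fibre a i) (dsrc a) :=
  ocomp (ocast (congr1 succn (sum_fibre a))) (vee_incl (fibre a) i).

Definition phi (a : dob) : @hom Dcat (conn (dsrc a)) a :=
  @Dhom (conn (dsrc a)) a (oid _) (oconst _) (eq_to_1 _ _).

Section Correspondence.
Variable C : cartesian.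

Definition simplicial : category := fun_cat (op Delta) C.
Definition dmonfun : category := monfun_cat Dmon (cart_monoidal C).

(* The common subcategory UDelta = op DeltaAct sits in op Delta through
   udelta_act and act_incl, and in D through the connected objects. *)
Definition res_simp (X : simplicial) : functor UDelta C :=
  fcomp (fcomp X (fop act_incl)) udelta_act.

Definition res_dmon (Xb : dmonfun) : functor UDelta C := fcomp Xb ud_incl.

Definition agree (X : simplicial) (Xb : dmonfun) : Prop :=
  res_simp X = res_dmon Xb.

(* The identity of X_n = Xb(n -> 1), as a pair of mutually inverse maps. *)
Definition agree_to X Xb (e : agree X Xb) (n : nat) :
    @hom C (fob X n) (fob (mfun Xb) (conn n)) :=
  eq_hom (congr1 (fun F : functor UDelta C => fob F n) e).

Definition agree_from X Xb (e : agree X Xb) (n : nat) :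
    @hom C (fob (mfun Xb) (conn n)) (fob X n) :=
  eq_hom (congr1 (fun F : functor UDelta C => fob F n) (esym e)).

(* The composite of Xb(phi) with the identification of Xb(a) with the product
   of the X_{m_i}, as a map X_m -> \prod_i X_{m_i}. *)
Definition phi_map X Xb (e : agree X Xb) (a : dob) :
    @hom (cart_monoidal C) (fob X (dsrc a))
      (bigtens (fun i => fob X (fibre a i) : cart_monoidal C)) :=
  bigtuple (fun i => agree_from e (fibre a i) ∘ bigproj _ i) ∘
  (mdecomp Xb (fun i => conn (fibre a i)) ∘
   fmap (mfun Xb) (eq_hom (ext_sum_decomp a)) ∘
   fmap (mfun Xb) (phi a) ∘
   agree_to e (dsrc a)).

Definition inert_condition X Xb (e : agree X Xb) : Prop :=
  forall a : dob,
    phi_map e a = bigtuple (fun i => fmap X (inert_incl i)) /\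
    forall i, fmap X (inert_incl i) = bigproj _ i ∘ phi_map e a.

Definition correspond (X : simplicial) (Xb : dmonfun) : Prop :=
  exists e : agree X Xb, inert_condition e.

Definition correspond_hom X Y Xb Yb (s : @hom simplicial X Y)
    (t : @hom dmonfun Xb Yb) : Prop :=
  exists (e : agree X Xb) (e' : agree Y Yb),
    forall n : nat,
      (mnt t (conn n) : @hom C _ _) ∘ agree_to e n
        = agree_to e' n ∘ (nt s n : @hom C _ _).

End Correspondence.

(* Main.v *)
(* In a cartesian target, a monoidal functor F on D acquires projections
   F (a + b) -> F a and F (a + b) -> F b, natural in both variables. A morphism
   s : a -> l + (n -> 1) + r of D followed by the projection onto the middle
   therefore gives F a -> F (n -> 1). Factoring s through the splitting of a
   that it induces shows that this map depends only on the element i of the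
   target of a and on the map d : [n] -> [m], landing in the fibre over i, that
   s determines. For a = (m -> 1) every map d arises, by adjoining a bottom and a
   top to [n], so n |-> F (n -> 1) extends to a simplicial object: active maps
   give back F on connected objects, and the inert inclusions of the fibres of a
   give the components of F (phi). Since F is monoidal, these same components
   exhibit F a as the product of the F (m_i -> 1).

   Conversely a simplicial object X sends a to the product of the X (m_i), and a
   morphism (g, f) : a -> b to the map whose component at j is induced by
   restricting the dual of g to the fibre over j, which it sends into the fibre
   of a over f j. All the coherence laws can be checked on components, where
   they become identities between monotone maps. *)

From mathcomp Require Import all_boot zify.
From Stdlib Require Import FunctionalExtensionality ProofIrrelevance.
Require Import Defs.

Set Implicit Arguments.
Unset Strict Implicit.
Unset Printing Implicit Defensive.
Local Open Scope cat_scope.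
Arguments fibre : clear implicits.

Lemma ltn_ext k l : (forall x, (x < k) = (x < l)) -> k = l.
Proof.
move=> h; apply/eqP; rewrite eqn_leq; apply/andP; split.
- by rewrite leqNgt h ltnn.
- by rewrite leqNgt -h ltnn.
Qed.

(** * Monotone maps of finite ordinals *)

Section NatExtension.

(* Beyond the domain, f is continued as a translation, so that composition,
   ordinal sum and adjunction hold on all of nat without side conditions. *)
Definition oext m n (f : omap m n) (x : nat) : nat :=
  if insub x is Some i then f i else n + (x - m).

Lemma oext_ord m n (f : omap m n) (i : 'I_m) : oext f i = f i.
Proof. by rewrite /oext valK. Qed.

Lemma oext_ltE m n (f : omap m n) x (h : x < m) :
  oext f x = f (Ordinal h).
Proof. by rewrite -(oext_ord f (Ordinal h)). Qed.

Lemma oext_ge m n (f : omap m n) x : m <= x -> oext f x = n + (x - m).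
Proof. by move=> h; rewrite /oext insubN // -leqNgt. Qed.

Lemma oext_lt m n (f : omap m n) x : x < m -> oext f x < n.
Proof. by move=> h; rewrite oext_ltE. Qed.

Lemma oext_mono m n (f : omap m n) x y : x <= y -> oext f x <= oext f y.
Proof.
move=> xy; have [ym|my] := ltnP y m.
  have xm := leq_ltn_trans xy ym.
  by rewrite !oext_ltE; apply: omono.
have [xm|mx] := ltnP x m; last by rewrite !oext_ge //; lia.
by rewrite (oext_ge f my) ltnW // ltn_addr // oext_lt.
Qed.

Lemma omap_oext m n (f g : omap m n) :
  (forall x, x < m -> oext f x = oext g x) -> f = g.
Proof.
move=> h; apply: omapP => i; apply: val_inj.
by have := h i (ltn_ord i); rewrite !oext_ord.
Qed.

Lemma oext_id n x : oext (oid n) x = x.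
Proof.
by have [h|h] := ltnP x n; [rewrite oext_ltE | rewrite oext_ge //; lia].
Qed.

Lemma oext_cast m n (e : m = n) x : oext (ocast e) x = x.
Proof. by subst n; rewrite ocast_id oext_id. Qed.

Lemma oext_comp m n p (g : omap n p) (f : omap m n) x :
  oext (ocomp g f) x = oext g (oext f x).
Proof.
have [h|h] := ltnP x m; first by rewrite !(oext_ltE _ h) oext_ord.
by rewrite !(oext_ge _ h) oext_ge ?leq_addr // addKn.
Qed.

Lemma oext_osum m n m' n' (f : omap m n) (f' : omap m' n') x :
  oext (osum f f') x = if x < m then oext f x else n + oext f' (x - m).
Proof.
have [h|h] := ltnP x m.
  have -> : x = lshift m' (Ordinal h) by [].
  by rewrite oext_ord osum_lshift /= -oext_ltE.
have [h'|h'] := ltnP (x - m) m'.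
  have -> : x = rshift m (Ordinal h') by rewrite /= subnKC.
  by rewrite oext_ord osum_rshift /= -oext_ltE addKn.
by rewrite !oext_ge; lia.
Qed.

Lemma oext_const n x : x < n -> oext (oconst n) x = 0.
Proof. by move=> h; rewrite oext_ltE. Qed.

Definition omk m n (f : nat -> nat) (fb : forall x, x < m -> f x < n)
    (fm : forall x y, x <= y -> y < m -> f x <= f y) : omap m n :=
  @Omap m n (fun i => Ordinal (fb i (ltn_ord i)))
    (fun i j ij => fm i j ij (ltn_ord j)).

Arguments omk : simpl never.

Lemma oext_mk m n f fb fm x : x < m -> oext (@omk m n f fb fm) x = f x.
Proof. by move=> h; rewrite oext_ltE. Qed.

(** The dual map [n] -> [m] of g, continued past n by translation like [oext]. It is characterized
    by the Galois connection [oadjP], which [oadj_eq] turns into a way of computing it. *)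
Definition oadj m n (g : omap m n) (c : nat) : nat :=
  if c <= n then #|[set x | (g x < c)%N]| else m + (c - n).

Lemma oadjP m n (g : omap m n) x c : (oext g x < c) = (x < oadj g c).
Proof.
have [h|h] := ltnP x m; rewrite /oadj; case: ifP => cn.
- by rewrite oext_ltE omap_ltE.
- by have := oext_lt g h; lia.
- have := max_card [set x | (g x < c)%N]; rewrite card_ord oext_ge //.
  by move: #|_| => ?; lia.
- by rewrite oext_ge //; lia.
Qed.

Lemma oadj_eq m n (g : omap m n) c k :
  (forall x, (oext g x < c) = (x < k)) -> oadj g c = k.
Proof. by move=> h; apply: ltn_ext => x; rewrite -oadjP. Qed.

Lemma oadj_id n c : oadj (oid n) c = c.
Proof. by apply: oadj_eq => x; rewrite oext_id. Qed.

Lemma oadj_cast m n (e : m = n) c : oadj (ocast e) c = c.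
Proof. by apply: oadj_eq => x; rewrite oext_cast. Qed.

Lemma oadj_comp m n p (g : omap n p) (f : omap m n) c :
  oadj (ocomp g f) c = oadj f (oadj g c).
Proof. by apply: oadj_eq => x; rewrite oext_comp !oadjP. Qed.

Lemma oadj_mono m n (g : omap m n) c d : c <= d -> oadj g c <= oadj g d.
Proof.
move=> cd; rewrite leqNgt; apply/negP => h.
have := ltnn (oadj g d); have := h.
by rewrite -oadjP => /leq_trans/(_ cd); rewrite oadjP => ->.
Qed.

Lemma oadj0 m n (g : omap m n) : oadj g 0 = 0.
Proof. by apply: oadj_eq. Qed.

Lemma oadj_top m n (g : omap m n) : oadj g n = m.
Proof.
apply: oadj_eq => x; have [h|h] := ltnP x m; first by rewrite oext_lt.
by rewrite oext_ge // ltnNge leq_addr.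
Qed.

Lemma oadj_le m n (g : omap m n) c : c <= n -> oadj g c <= m.
Proof. by move=> h; rewrite -[leqRHS](oadj_top g) oadj_mono. Qed.

Lemma oadj_osum m n m' n' (f : omap m n) (f' : omap m' n') c :
  oadj (osum f f') c = if c <= n then oadj f c else m + oadj f' (c - n).
Proof.
apply: oadj_eq => x; rewrite oext_osum; case: ifP => xm; case: ifP => cn.
- by rewrite oadjP.
- have := oext_lt f xm; lia.
- have := oadj_le f cn; lia.
- rewrite -ltn_subLR; last lia.
  by rewrite -oadjP; lia.
Qed.

Lemma oadj_osum_l m n m' n' (f : omap m n) (f' : omap m' n') c :
  c <= n -> oadj (osum f f') c = oadj f c.
Proof. by rewrite oadj_osum => ->. Qed.

(** At c = 0 the sum formula falls in its first branch; the two branches agree there because a dual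
    preserves top and bottom. *)
Lemma oadj_osum_r m n m' n' (f : omap m n) (f' : omap m' n') c :
  oadj (osum f f') (n + c) = m + oadj f' c.
Proof.
rewrite oadj_osum addKn; case: ifP => //; rewrite -[leqRHS]addn0 leq_add2l leqn0.
by move/eqP->; rewrite !addn0 oadj0 addn0 oadj_top.
Qed.

Lemma oext_osum_r m n m' n' (f : omap m n) (f' : omap m' n') x :
  oext (osum f f') (m + x) = n + oext f' x.
Proof. by rewrite oext_osum addKn ltnNge leq_addr. Qed.

Lemma oext_osum_l m n m' n' (f : omap m n) (f' : omap m' n') x :
  x < m -> oext (osum f f') x = oext f x.
Proof. by rewrite oext_osum => ->. Qed.

Lemma oadj_inj m n (f g : omap m n) :
  (forall c, c <= n -> oadj f c = oadj g c) -> f = g.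
Proof.
move=> h; apply: omap_oext => x xm; apply: ltn_ext => y.
have [yn|yn] := ltnP y n.
  by rewrite !ltnNge -(ltnS (oext f x)) -(ltnS (oext g x)) !oadjP h.
have := oext_lt f xm; have := oext_lt g xm; lia.
Qed.

Lemma precompE m n (g : omap m n) (c : 'I_n.+1) :
  precomp_fun g c = oadj g c :> nat.
Proof.
have cn : c <= n by rewrite -ltnS.
rewrite /oadj cn /=; apply: eq_card => x; rewrite !inE.
exact: (of_cut_eq0 c).
Qed.

End NatExtension.

Definition pre m n (g : omap m n) : @hom Delta n m := Omap (precomp_mono g).

Lemma preE m n (g : omap m n) (c : 'I_n.+1) : pre g c = oadj g c :> nat.
Proof. exact: precompE. Qed.

Lemma pre_id n : pre (oid n) = idm (n : Delta).
Proof. by apply: omapP => c; apply: ord_inj; rewrite [LHS]preE oadj_id. Qed.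

Lemma pre_comp m n p (g : omap n p) (f : omap m n) :
  pre (ocomp g f) = pre f ∘ pre g.
Proof.
apply: omapP => c; apply: ord_inj.
by rewrite [LHS]preE oadj_comp [RHS]preE preE.
Qed.

Lemma pre_castE m n (e : m = n) (c : 'I_n.+1) : pre (ocast e) c = c :> nat.
Proof. by rewrite preE oadj_cast. Qed.

Lemma pre_cast m n (e : m = n) :
  pre (ocast e) = ocast (congr1 succn (esym e)) :> omap _ _.
Proof. by apply: omapP => c; apply: ord_inj; rewrite pre_castE. Qed.

(** * Fibres of an object and maps landing in one of them *)

Section Fibres.
Variable a : dob.
Implicit Type i : 'I_(dtgt a).

Lemma oadj_card i : oadj (darr a) i = #|[set x | (darr a x < i)%N]|.
Proof. by rewrite /oadj ltnW. Qed.

Lemma oadj_fibre i : oadj (darr a) i.+1 = oadj (darr a) i + fibre a i.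
Proof.
rewrite oadj_card /oadj ltn_ord /fibre -!sum1dep_card.
rewrite (bigID (fun x => (darr a x < i)%N)) /=; congr addn; apply: eq_bigl => x.
- by rewrite ltnS andbC; case: ltngtP.
- by rewrite ltnS -leqNgt -eqn_leq.
Qed.

Lemma sum_fibre_lt i : \sum_(l < dtgt a | (l < i)%N) fibre a l = oadj (darr a) i.
Proof.
rewrite oadj_card -sum1dep_card.
rewrite (partition_big (darr a) (fun l : 'I__ => (l < i)%N)) //=.
apply: eq_bigr => l li; rewrite /fibre -sum1dep_card; apply: eq_bigl => x.
by case: eqP => [->|]; rewrite ?li ?andbF.
Qed.

Lemma inert_inclE i (c : 'I_(fibre a i).+1) :
  inert_incl i c = oadj (darr a) i + c :> nat.
Proof. by rewrite /= /vee_incl_val sum_fibre_lt. Qed.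

(** In [m], the fibre over i occupies the interval between the values of the dual of a at i and at i
    + 1; bounded maps are those that factor through [inert_incl i]. *)
Definition bounded i n (d : @hom Delta n (dsrc a)) : Prop :=
  forall c, oadj (darr a) i <= (d : omap _ _) c <= oadj (darr a) i.+1.

Lemma restr_lt i n (d : @hom Delta n (dsrc a)) (c : 'I_n.+1) :
  minn ((d : omap _ _) c - oadj (darr a) i) (fibre a i) < (fibre a i).+1.
Proof. by rewrite ltnS geq_minr. Qed.

(* The factorization of d through the inert inclusion at i, meaningful only for
   bounded d: the formula clamps the other values. *)
Definition restr i n (d : @hom Delta n (dsrc a)) : @hom Delta n (fibre a i).
Proof.
refine (@Omap _ _ (fun c => Ordinal (restr_lt i d c)) _) => x y xy /=.
by have := omono d xy; lia.
Defined.

Lemma restrE i n (d : @hom Delta n (dsrc a)) (c : 'I_n.+1) :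
  (restr i d : omap _ _) c
    = minn ((d : omap _ _) c - oadj (darr a) i) (fibre a i) :> nat.
Proof. by []. Qed.

Lemma incl_restr i n (d : @hom Delta n (dsrc a)) :
  bounded i d -> @ccomp Delta _ _ _ (inert_incl i) (restr i d) = d.
Proof.
move=> db; apply: omapP => c; apply: ord_inj.
rewrite [LHS]inert_inclE restrE; have := db c; rewrite oadj_fibre; lia.
Qed.

Lemma bounded_incl i : bounded i (inert_incl i).
Proof.
move=> c; rewrite inert_inclE oadj_fibre; have := ltn_ord c; lia.
Qed.

Lemma restr_incl i : restr i (inert_incl i) = idm _.
Proof.
apply: omapP => c; apply: ord_inj; rewrite restrE inert_inclE /=.
have := ltn_ord c; lia.
Qed.

Lemma restr_comp i n p (d : @hom Delta n (dsrc a)) (e : @hom Delta p n) :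
  restr i (d ∘ e) = restr i d ∘ e.
Proof. by apply: omapP => c; apply: val_inj. Qed.

End Fibres.

(** By adjunction the dual of [dsnd t] sends [dsnd t j] to at most j and the next element to at
    least j + 1. Applying the monotone duals of b and of [dfst t] to these bounds gives the fibre
    interval of a. *)
Lemma bounded_pre a b (t : dhom a b) j n (d : @hom Delta n (dsrc b)) :
  bounded j d -> bounded (dsnd t j) (pre (dfst t) ∘ d).
Proof.
move=> db c; have /andP[d1 d2] := db c.
rewrite (dhomP t) !oadj_comp.
have -> : (pre (dfst t) ∘ d : omap _ _) c = oadj (dfst t) ((d : omap _ _) c) :> nat.
  exact: preE.
have e : oext (dsnd t) j = dsnd t j by rewrite oext_ord.
apply/andP; split; apply: oadj_mono.
- apply: leq_trans d1; apply: oadj_mono.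
  by rewrite leqNgt -oadjP e ltnn.
- apply: (leq_trans d2); apply: oadj_mono.
  by rewrite -oadjP e.
Qed.

Lemma bounded_conn n m (d : @hom Delta m n) : @bounded (conn n) ord0 m d.
Proof.
move=> c; have -> : oadj (darr (conn n)) (ord0 : 'I_1) = 0 by rewrite oadj0.
have -> : oadj (darr (conn n)) (ord0 : 'I_1).+1 = n by apply: oadj_top.
by apply/andP; split=> //; rewrite -ltnS; apply: ltn_ord.
Qed.

Lemma oshift_lt p n q (c : 'I_n.+1) : p + c < (p + (n + q)).+1.
Proof. by have := ltn_ord c; lia. Qed.

Definition oshift p n q : @hom Delta n (p + (n + q)).
Proof.
refine (@Omap _ _ (fun c => Ordinal (oshift_lt p q c)) _) => x y xy /=.
by rewrite leq_add2l.
Defined.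

(** * Middle summands in D *)

(* A morphism a -> l + (n -> 1) + r followed by the projection onto the middle
   summand amounts to a map [n] -> [m] landing in the fibre of a over an
   element of the target of a. *)
Section Middle.
Variables (a l r : dob) (n : nat) (s : dhom a (dsum l (dsum (conn n) r))).

Definition mid_idx : 'I_(dtgt a) :=
  dsnd s (rshift (dtgt l) (lshift (dtgt r) (ord0 : 'I_1))).

Definition mid_map : @hom Delta n (dsrc a) :=
  pre (dfst s) ∘ oshift (dsrc l) n (dsrc r).

Lemma mid_idxE : mid_idx = oext (dsnd s) (dtgt l) :> nat.
Proof. by rewrite -(oext_ord (dsnd s)) /= addn0. Qed.

Lemma mid_mapE (c : 'I_n.+1) :
  (mid_map : omap _ _) c = oadj (dfst s) (dsrc l + c) :> nat.
Proof. exact: preE. Qed.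

Lemma mid_darr x : oext (darr a) x = oext (dsnd s)
  (oext (osum (darr l) (osum (oconst n) (darr r))) (oext (dfst s) x)).
Proof. by rewrite [in LHS](dhomP s) !oext_comp. Qed.

Lemma mid_bounded : bounded mid_idx mid_map.
Proof.
move=> c; rewrite mid_mapE (dhomP s) !oadj_comp /= !oadj_osum.
have e := mid_idxE.
have h1 : oadj (dsnd s) mid_idx <= dtgt l by rewrite leqNgt -oadjP e ltnn.
have h2 : dtgt l < oadj (dsnd s) mid_idx.+1 by rewrite -oadjP e.
apply/andP; split; apply: oadj_mono.
- by rewrite h1; apply: leq_trans (leq_addr _ _); apply: oadj_le.
- rewrite [_ <= dtgt l]leqNgt h2 /= leq_add2l.
  case: ifP => h3; last by have := ltn_ord c; lia.
  have -> : oadj (dsnd s) mid_idx.+1 - dtgt l = 1.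
    by apply/eqP; rewrite eqn_leq h3 subn_gt0.
  by rewrite oadj_top -ltnS.
Qed.
End Middle.

(** * Splitting an object around a window inside one fibre *)

Section Split.
Variables (a : dob) (i : 'I_(dtgt a)) (p w : nat).
Hypothesis (p_ge : oadj (darr a) i <= p) (p_le : p + w <= oadj (darr a) i.+1).

Let lew : p + w <= dsrc a.
Proof. by apply: leq_trans p_le (oadj_le _ _). Qed.

(** The fibre over i may continue on both sides of the window from p to p + w. Hence i is kept as
    the last target element on the left, as the target of the middle part and as the first target
    element on the right. *)
Definition split_left : dob.
Proof.
refine (@Dob p i.+1 (omk (f := oext (darr a)) _ _)) => [x xp|x y xy _].
- by rewrite oadjP; apply: leq_trans p_le; lia.
- exact: oext_mono.
Defined.

Definition split_right : dob.
Proof.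
refine (@Dob (dsrc a - (p + w)) (dtgt a - i)
  (omk (f := fun x => oext (darr a) (x + (p + w)) - i) _ _)) => [x xp|x y xy _].
- have := @oext_lt _ _ (darr a) (x + (p + w)); have := ltn_ord i; lia.
- by rewrite leq_sub2r // oext_mono // leq_add2r.
Defined.

(** Merges the three copies i, i + 1 and i + 2 of the target element i. *)
Definition split_snd_fun (y : nat) : nat :=
  if y <= i then y else if y == i.+1 then i : nat else y - 2.

Definition split_snd : omap (i.+1 + (1 + (dtgt a - i))) (dtgt a).
Proof.
refine (omk (f := split_snd_fun) _ _) => [x|x y];
  rewrite /split_snd_fun; have := ltn_ord i; do ?case: ifP; lia.
Defined.

Let split_src : dsrc a = p + (w + (dsrc a - (p + w))).
Proof. lia. Qed.

Definition split_mid :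
  dhom a (dsum split_left (dsum (conn w) split_right)).
Proof.
refine (@Dhom a (dsum split_left (dsum (conn w) split_right))
  (ocast split_src) split_snd _).
apply: omap_oext => x xm; rewrite !oext_comp oext_cast !oext_osum /=.
have [h|h] := ltnP x p.
  have e : oext (darr a) x <= i by rewrite -ltnS oadjP; lia.
  by rewrite [oext _ x in RHS]oext_mk // oext_mk /split_snd_fun ?e //; lia.
have e1 := oadjP (darr a) x i; have e2 := oadjP (darr a) x i.+1.
have i_lt := ltn_ord i; have a_lt := oext_lt (darr a) xm.
case: ifP => h2.
  by rewrite oext_const // oext_mk /split_snd_fun; do ?case: ifP; lia.
rewrite [oext _ (x - p - w)]oext_mk; last by lia.
have -> : x - p - w + (p + w) = x by lia.
by rewrite oext_mk /split_snd_fun; do ?case: ifP; lia.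
Defined.

Lemma split_idx : mid_idx split_mid = i.
Proof.
apply: ord_inj; rewrite mid_idxE /= oext_mk /split_snd_fun; last lia.
by rewrite ltnn eqxx.
Qed.

Lemma split_mapE (c : 'I_w.+1) : (mid_map split_mid : omap _ _) c = p + c :> nat.
Proof. by rewrite mid_mapE /= oadj_cast. Qed.

Section Factor.
Variables (l r : dob) (n : nat) (s : dhom a (dsum l (dsum (conn n) r))).
Hypothesis (midi : mid_idx s = i).
Hypothesis (mid0 : oadj (dfst s) (dsrc l) = p).
Hypothesis (mid1 : oadj (dfst s) (dsrc l + n) = p + w).

Let i_ext : oext (dsnd s) (dtgt l) = i.
Proof. by rewrite -mid_idxE midi. Qed.

Let gp x : (oext (dfst s) x < dsrc l) = (x < p).
Proof. by rewrite oadjP mid0. Qed.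

Let gw x : (oext (dfst s) x < dsrc l + n) = (x < p + w).
Proof. by rewrite oadjP mid1. Qed.

Definition factor_left_src : omap p (dsrc l).
Proof.
refine (omk (f := oext (dfst s)) _ _) => [x|x y xy _]; first by rewrite gp.
exact: oext_mono.
Defined.

Definition factor_left_tgt : omap (dtgt l) i.+1.
Proof.
refine (omk (f := oext (dsnd s)) _ _) => [y yl|x y xy _].
- by rewrite ltnS -i_ext oext_mono // ltnW.
- exact: oext_mono.
Defined.

Definition factor_left : dhom split_left l.
Proof.
refine (@Dhom split_left l factor_left_src factor_left_tgt _).
apply: omap_oext => x xp; have gx : oext (dfst s) x < dsrc l by rewrite gp.
rewrite !oext_comp [oext factor_left_src x]oext_mk // !oext_mk //.
  by rewrite (mid_darr s) !oext_osum gx.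
exact: oext_lt.
Defined.

Definition factor_mid : omap w n.
Proof.
refine (omk (f := fun x => oext (dfst s) (x + p) - dsrc l) _ _).
- move=> x xw; have := gw (x + p); have := gp (x + p); lia.
- by move=> x y xy _; rewrite leq_sub2r // oext_mono // leq_add2r.
Defined.

Definition factor_right_src : omap (dsrc a - (p + w)) (dsrc r).
Proof.
refine (omk
  (f := fun x => oext (dfst s) (x + (p + w)) - (dsrc l + n)) _ _) => [x xw|x y xy _].
- have := @oext_lt _ _ (dfst s) (x + (p + w)).
  have := gw (x + (p + w)); rewrite /=; lia.
- by rewrite leq_sub2r // oext_mono // leq_add2r.
Defined.

Definition factor_right_tgt : omap (dtgt r) (dtgt a - i).
Proof.
refine (omk
  (f := fun y => oext (dsnd s) (y + (dtgt l).+1) - i) _ _) => [y yr|x y xy _].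
- have := @oext_lt _ _ (dsnd s) (y + (dtgt l).+1).
  have := ltn_ord i; move: (oext (dsnd s) _) => v /=; lia.
- by rewrite leq_sub2r // oext_mono // leq_add2r.
Defined.

Definition factor_right : dhom split_right r.
Proof.
refine (@Dhom split_right r factor_right_src factor_right_tgt _).
apply: omap_oext => x xp.
have h : dsrc l + n <= oext (dfst s) (x + (p + w)).
  by have := gw (x + (p + w)); lia.
have h' : oext (dfst s) (x + (p + w)) < dsrc l + (n + dsrc r).
  by apply: (oext_lt (dfst s)); move: xp => /=; lia.
rewrite !oext_comp [oext factor_right_src x]oext_mk // [LHS]oext_mk //.
rewrite oext_mk; last by apply: oext_lt; lia.
rewrite (mid_darr s) !oext_osum ifF; last by lia.
rewrite ifF; last by lia.
congr (oext _ _ - _).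
by rewrite subnDA /=; lia.
Defined.

(** Under [dfst s] the preimages of l and of the middle summand are the parts below p and from p to
    p + w, so s cuts into three pieces along the split. Only the three factors depend on s;
    [split_mid] does not. *)
Lemma split_factor :
  s = dcomp (dsumm factor_left (dsumm (conn_hom factor_mid) factor_right)) split_mid.
Proof.
apply: dhom_ext; apply: omap_oext => x /= xa;
  rewrite oext_comp ?oext_cast !oext_osum /=.
- move: (gp x) (gw x) => /= gpx gwx; case: ifP => h1; first by rewrite oext_mk.
  case: ifP => h2.
    have e : x - p + p = x by lia.
    by rewrite oext_mk // e /=; lia.
  have e : x - p - w + (p + w) = x by lia.
  by rewrite oext_mk ?e /=; lia.
- have i_lt := ltn_ord i.
  case: ifP => h1.
    have h : oext (dsnd s) x <= i by rewrite -i_ext oext_mono // ltnW.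
    by rewrite oext_mk // oext_mk /split_snd_fun ?h //; lia.
  case: ifP => h2.
    have -> : x = dtgt l by lia.
    rewrite subnn oext_id oext_mk /split_snd_fun; last lia.
    by rewrite addn0 ltnn eqxx i_ext.
  have e : x - dtgt l - 1 + (dtgt l).+1 = x by lia.
  have va := oext_lt (dsnd s) xa; have iv : i <= oext (dsnd s) x.
    by rewrite -i_ext oext_mono //; lia.
  rewrite [oext _ (x - _ - _)]oext_mk; last by lia.
  rewrite e /=; move: (oext (dsnd s) x) iv va => v iv va.
  by rewrite oext_mk /split_snd_fun; do ?case: ifP; lia.
Qed.

(** Up to the shift by p, the dual of the middle factor is the restriction of the dual of [dfst s]
    to the middle, hence is determined by [mid_map s]. *)
Lemma factor_midE c : c <= n -> p + oadj factor_mid c = oadj (dfst s) (dsrc l + c).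
Proof.
move=> cn; have h : oadj (dfst s) (dsrc l + c) <= p + w.
  by rewrite -mid1 oadj_mono // leq_add2l.
have h0 : p <= oadj (dfst s) (dsrc l + c) by rewrite -mid0 oadj_mono ?leq_addr.
suff -> : oadj factor_mid c = oadj (dfst s) (dsrc l + c) - p by lia.
apply: oadj_eq => x; have [xw|xw] := ltnP x w.
- rewrite oext_mk // ltn_subRL addnC -oadjP.
  by have := gp (x + p); rewrite addnC; lia.
- by rewrite oext_ge //; lia.
Qed.

End Factor.
End Split.

(** * From monoidal functors to simplicial objects *)

Section EqHom.
Variable C : category.

Lemma iso_epi (a b c : C) (f : iso a b) (h h' : hom b c) :
  h ∘ fwd f = h' ∘ fwd f -> h = h'.
Proof. by move=> e; rewrite -[h]ccompm1 -(bwdK f) ccompA e -ccompA bwdK ccompm1. Qed.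

Lemma iso_eq (a b : C) (f g : iso a b) : fwd f = fwd g -> f = g.
Proof.
case: f g => [f f' fK f'K] [g g' gK g'K] /= e; subst g.
have e : f' = g' by rewrite -[f']ccompm1 -g'K ccompA fK ccomp1m.
by subst g'; rewrite (proof_irrelevance _ fK gK) (proof_irrelevance _ f'K g'K).
Qed.

Lemma eq_hom_id (a : C) (e : a = a) : eq_hom e = idm a.
Proof. by rewrite (proof_irrelevance _ e erefl). Qed.

Lemma eq_hom_irr (a b : C) (e e' : a = b) : eq_hom e = eq_hom e'.
Proof. by rewrite (proof_irrelevance _ e e'). Qed.

Lemma eq_homK (a b : C) (e : a = b) : eq_hom (esym e) ∘ eq_hom e = idm a.
Proof. by case: b / e; apply: ccomp1m. Qed.

Lemma eq_homVK (a b : C) (e : a = b) : eq_hom e ∘ eq_hom (esym e) = idm b.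
Proof. by case: b / e; apply: ccomp1m. Qed.

Lemma eq_hom_trans (a b c : C) (e : a = b) (e' : b = c) :
  eq_hom e' ∘ eq_hom e = eq_hom (etrans e e').
Proof. by case: c / e'; apply: ccomp1m. Qed.

End EqHom.

Section FunctorEq.
Variables A B : category.

Lemma functor_map_eq (f : A -> B)
    (m m' : forall a b, hom a b -> hom (f a) (f b)) m1 mM m1' mM' :
  (forall a b (h : hom a b), m a b h = m' a b h) ->
  @Functor A B f m m1 mM = @Functor A B f m' m1' mM'.
Proof.
move=> e; have {}e : m = m'.
  do 3 (apply: functional_extensionality_dep => ?); exact: e.
subst m'; by rewrite (proof_irrelevance _ m1 m1') (proof_irrelevance _ mM mM').
Qed.

Lemma eq_functor_nat (F G : functor A B) (e : F = G) a b (f : hom a b) :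
  fmap G f ∘ eq_hom (congr1 (fun H : functor A B => fob H a) e)
  = eq_hom (congr1 (fun H : functor A B => fob H b) e) ∘ fmap F f.
Proof. by case: G / e; rewrite /= ccompm1 ccomp1m. Qed.

(** Converse of [eq_functor_nat]; it serves to recover X strictly from a corresponding monoidal
    functor. *)
Lemma eq_functor (F G : functor A B) (e : fob F = fob G) :
  (forall a b (f : hom a b), fmap G f ∘ eq_hom (congr1 (fun h => h a) e)
     = eq_hom (congr1 (fun h => h b) e) ∘ fmap F f) -> F = G.
Proof.
case: F G e => [f m m1 mM] [g m' m1' mM'] /= e; subst g => h.
by apply: functor_map_eq => a b u; have := h _ _ u; rewrite /= ccompm1 ccomp1m.
Qed.

End FunctorEq.

(** * Projections of a monoidal functor with cartesian target *)

Section Projections.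
Variables (C : cartesian) (F : monfunctor Dmon (cart_monoidal C)).
Local Notation N := (cart_monoidal C).
Implicit Types a b c l r : dob.

Local Notation fst1 a b := (@cfst C a b : @hom N (@tens N a b) a).
Local Notation snd1 a b := (@csnd C a b : @hom N (@tens N a b) b).

Lemma tens_fst (a b c d : N) (f : hom a b) (g : hom c d) :
  fst1 b d ∘ (f ⊗₁ g) = f ∘ fst1 a c.
Proof. exact: cfstP. Qed.

Lemma tens_snd (a b c d : N) (f : hom a b) (g : hom c d) :
  snd1 b d ∘ (f ⊗₁ g) = g ∘ snd1 a c.
Proof. exact: csndP. Qed.

Lemma tens_fstA (a b c d x : N) (f : hom a b) (g : hom c d) (h : hom x (a ⊗ c)) :
  fst1 b d ∘ ((f ⊗₁ g) ∘ h) = f ∘ (fst1 a c ∘ h).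
Proof. by rewrite !ccompA tens_fst. Qed.

Lemma tens_sndA (a b c d x : N) (f : hom a b) (g : hom c d) (h : hom x (a ⊗ c)) :
  snd1 b d ∘ ((f ⊗₁ g) ∘ h) = g ∘ (snd1 a c ∘ h).
Proof. by rewrite !ccompA tens_snd. Qed.

Lemma assoc_fst (a b c : N) :
  fst1 a (b ⊗ c) ∘ fwd (massoc a b c) = fst1 a b ∘ fst1 (a ⊗ b) c.
Proof. exact: cfstP. Qed.

Lemma assoc_snd_fst (a b c : N) :
  fst1 b c ∘ (snd1 a (b ⊗ c) ∘ fwd (massoc a b c)) = snd1 a b ∘ fst1 (a ⊗ b) c.
Proof. exact: (etrans (congr1 (ccomp _) (csndP _ _)) (cfstP _ _)). Qed.

Lemma assoc_snd_snd (a b c : N) :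
  snd1 b c ∘ (snd1 a (b ⊗ c) ∘ fwd (massoc a b c)) = snd1 (a ⊗ b) c.
Proof. exact: (etrans (congr1 (ccomp _) (csndP _ _)) (csndP _ _)). Qed.

Definition tensE := (tens_fst, tens_snd, tens_fstA, tens_sndA,
  assoc_fst, assoc_snd_fst, assoc_snd_snd).

(* Unless projl is locked, rewriting with the associativity of composition
   unfolds it; the same applies to the other locked definitions below. *)
Definition projl a b : @hom N (F (dsum a b)) (F a) :=
  locked (fst1 _ _ ∘ bwd (mmu F a b)).

Definition projr a b : @hom N (F (dsum a b)) (F b) :=
  locked (snd1 _ _ ∘ bwd (mmu F a b)).

Lemma projlE a b : projl a b = fst1 _ _ ∘ bwd (mmu F a b).
Proof. by rewrite /projl -lock. Qed.

Lemma projrE a b : projr a b = snd1 _ _ ∘ bwd (mmu F a b).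
Proof. by rewrite /projr -lock. Qed.

Lemma projl_mu a b : projl a b ∘ fwd (mmu F a b) = fst1 _ _.
Proof. by rewrite projlE -ccompA fwdK ccompm1. Qed.

Lemma projr_mu a b : projr a b ∘ fwd (mmu F a b) = snd1 _ _.
Proof. by rewrite projrE -ccompA fwdK ccompm1. Qed.

Lemma projl_muA a b (x : N) (h : hom x (F a ⊗ F b)) :
  projl a b ∘ (fwd (mmu F a b) ∘ h) = fst1 _ _ ∘ h.
Proof. by rewrite ccompA projl_mu. Qed.

Lemma projr_muA a b (x : N) (h : hom x (F a ⊗ F b)) :
  projr a b ∘ (fwd (mmu F a b) ∘ h) = snd1 _ _ ∘ h.
Proof. by rewrite ccompA projr_mu. Qed.

Definition projE := (projl_mu, projr_mu, projl_muA, projr_muA, tensE).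

Lemma projl_nat a b a' b' (f : @hom Dmon a a') (g : @hom Dmon b b') :
  projl a' b' ∘ fmap F (f ⊗₁ g) = fmap F f ∘ projl a b.
Proof.
by apply: (iso_epi (f := mmu F a b)); rewrite -!ccompA -mmu_nat !projE.
Qed.

Lemma projr_nat a b a' b' (f : @hom Dmon a a') (g : @hom Dmon b b') :
  projr a' b' ∘ fmap F (f ⊗₁ g) = fmap F g ∘ projr a b.
Proof.
by apply: (iso_epi (f := mmu F a b)); rewrite -!ccompA -mmu_nat !projE.
Qed.

(** The composite of structure maps in the associativity axiom [mmuA] is invertible, so projections
    can be compared after it, where they become those of the cartesian product. *)
Lemma mu3_epi a b c (x : N) (h h' : hom (F (dsum (dsum a b) c)) x) :
  h ∘ (fwd (mmu F (dsum a b) c) ∘ (fwd (mmu F a b) ⊗₁ idm (F c)))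
    = h' ∘ (fwd (mmu F (dsum a b) c) ∘ (fwd (mmu F a b) ⊗₁ idm (F c)))
  -> h = h'.
Proof.
move=> e; apply: (iso_epi (f := mmu F (dsum a b) c)).
have K : (fwd (mmu F a b) ⊗₁ idm (F c)) ∘ (bwd (mmu F a b) ⊗₁ idm (F c)) = idm _.
  by rewrite -tensM bwdK ccomp1m tens1.
rewrite !ccompA in e.
by rewrite -[LHS]ccompm1 -[RHS]ccompm1 -K !ccompA e.
Qed.

Lemma projl_projl a b c : projl a b ∘ projl (dsum a b) c
  = projl a (dsum b c) ∘ fmap F (fwd (@massoc Dmon a b c)).
Proof. by apply: mu3_epi; rewrite -!ccompA mmuA !projE ?ccomp1m. Qed.

Lemma projr_projl a b c : projr a b ∘ projl (dsum a b) c
  = projl b c ∘ (projr a (dsum b c) ∘ fmap F (fwd (@massoc Dmon a b c))).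
Proof. by apply: mu3_epi; rewrite -!ccompA mmuA !projE ?ccomp1m. Qed.

Lemma projr_projr a b c : projr (dsum a b) c
  = projr b c ∘ (projr a (dsum b c) ∘ fmap F (fwd (@massoc Dmon a b c))).
Proof. by apply: mu3_epi; rewrite -!ccompA mmuA !projE ccomp1m. Qed.

(** After composition with the structure isomorphisms both sides are the left unit map of the
    product, by the unit axiom [mmu1l]. *)
Lemma projr_unit a : projr dzero a = fmap F (fwd (dlunit a)).
Proof.
apply: (iso_epi (f := mmu F dzero a)).
have K : (fwd (meps F) ⊗₁ idm (F a)) ∘ (bwd (meps F) ⊗₁ idm (F a)) = idm _.
  by rewrite -tensM bwdK ccomp1m tens1.
rewrite -[LHS]ccompm1 -[RHS]ccompm1 -K !ccompA; congr (_ ∘ _).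
by rewrite -!ccompA [RHS](mmu1l F a) !projE ccomp1m.
Qed.

Lemma projl_unit a : projl a dzero = fmap F (fwd (drunit a)).
Proof.
apply: (iso_epi (f := mmu F a dzero)).
have K : (idm (F a) ⊗₁ fwd (meps F)) ∘ (idm (F a) ⊗₁ bwd (meps F)) = idm _.
  by rewrite -tensM bwdK ccomp1m tens1.
rewrite -[LHS]ccompm1 -[RHS]ccompm1 -K !ccompA; congr (_ ∘ _).
by rewrite -!ccompA [RHS](mmu1r F a) !projE ccomp1m.
Qed.

Lemma projl_natA a b a' b' (f : @hom Dmon a a') (g : @hom Dmon b b')
    (x : N) (h : hom x _) :
  projl a' b' ∘ (fmap F (f ⊗₁ g) ∘ h) = fmap F f ∘ (projl a b ∘ h).
Proof. by rewrite !ccompA projl_nat. Qed.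

Lemma projr_natA a b a' b' (f : @hom Dmon a a') (g : @hom Dmon b b')
    (x : N) (h : hom x _) :
  projr a' b' ∘ (fmap F (f ⊗₁ g) ∘ h) = fmap F g ∘ (projr a b ∘ h).
Proof. by rewrite !ccompA projr_nat. Qed.

Lemma projl_assocA a b c (x : N) (h : hom x _) :
  projl a (dsum b c) ∘ (fmap F (fwd (@massoc Dmon a b c)) ∘ h)
    = projl a b ∘ (projl (dsum a b) c ∘ h).
Proof. by rewrite !ccompA projl_projl. Qed.

Lemma projlr_assocA a b c (x : N) (h : hom x _) :
  projl b c ∘ (projr a (dsum b c) ∘ (fmap F (fwd (@massoc Dmon a b c)) ∘ h))
    = projr a b ∘ (projl (dsum a b) c ∘ h).
Proof. by rewrite [RHS]ccompA projr_projl -!ccompA. Qed.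

Lemma projr_assocVA a b c (x : N) (h : hom x _) :
  projr (dsum a b) c ∘ (fmap F (bwd (@massoc Dmon a b c)) ∘ h)
    = projr b c ∘ (projr a (dsum b c) ∘ h).
Proof.
rewrite projr_projr -!ccompA (ccompA (fmap F (fwd _))) -fmapM bwdK fmap1.
by rewrite ccomp1m.
Qed.

Definition midproj a l c r (s : @hom Dmon a (dsum l (dsum c r))) : @hom N (F a) (F c) :=
  locked (projl c r ∘ (projr l (dsum c r) ∘ fmap F s)).

Lemma midproj_pre a b l c r (s : @hom Dmon b (dsum l (dsum c r))) (t : @hom Dmon a b) :
  midproj s ∘ fmap F t = midproj (s ∘ t).
Proof. by rewrite /midproj -!lock fmapM -!ccompA. Qed.

(** Naturality of the projections discards u and w. *)
Lemma midproj_post a l c r l' c' r' (s : @hom Dmon a (dsum l (dsum c r)))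
    (u : @hom Dmon l l') (v : @hom Dmon c c') (w : @hom Dmon r r') :
  midproj ((u ⊗₁ v ⊗₁ w) ∘ s) = fmap F v ∘ midproj s.
Proof. by rewrite /midproj -!lock fmapM projr_natA projl_natA. Qed.

(** Splits the middle summand of s further by s' and reassociates, so that l + l' and r' + r become
    the outer summands. *)
Definition subsplit a l c r l' c' r' (s : @hom Dmon a (dsum l (dsum c r)))
    (s' : @hom Dmon c (dsum l' (dsum c' r'))) :
    @hom Dmon a (dsum (dsum l l') (dsum c' (dsum r' r))) :=
  bwd (@massoc Dmon l l' (dsum c' (dsum r' r))) ∘
    ((@idm Dmon l ⊗₁ ((@idm Dmon l' ⊗₁ fwd (@massoc Dmon c' r' r)) ∘
                fwd (@massoc Dmon l' (dsum c' r') r)))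
      ∘ ((@idm Dmon l ⊗₁ s' ⊗₁ @idm Dmon r) ∘ s)).

Lemma midproj_comp a l c r l' c' r' (s : @hom Dmon a (dsum l (dsum c r)))
    (s' : @hom Dmon c (dsum l' (dsum c' r'))) :
  midproj s' ∘ midproj s = midproj (subsplit s s').
Proof.
rewrite /midproj -!lock /subsplit !fmapM -!ccompA projr_assocVA projr_natA.
rewrite fmapM -!ccompA projr_natA projl_assocA projlr_assocA.
by rewrite projr_natA projl_natA.
Qed.

(** Equal data give the same index and the same window, so s and s' factor through one and the same
    [split_mid]. Their outer factors disappear under the projection, and their middle factors
    coincide since their duals do. *)
Lemma midproj_ext a l r l' r' n (s : dhom a (dsum l (dsum (conn n) r)))
    (s' : dhom a (dsum l' (dsum (conn n) r'))) :
  mid_idx s = mid_idx s' -> mid_map s = mid_map s' -> midproj s = midproj s'.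
Proof.
move=> e1 e2.
have e x : x <= n -> oadj (dfst s) (dsrc l + x) = oadj (dfst s') (dsrc l' + x).
  rewrite -ltnS => xn; rewrite -(mid_mapE s (Ordinal xn)) e2; exact: mid_mapE.
(* The window runs between the images of the bottom and the top of [n] under [mid_map s]. *)
pose p := oadj (dfst s) (dsrc l).
pose w := oadj (dfst s) (dsrc l + n) - p.
have pw : p + w = oadj (dfst s) (dsrc l + n).
  by rewrite subnKC // oadj_mono // leq_addr.
have p0 : oadj (darr a) (mid_idx s) <= p.
  have /andP[+ _] := mid_bounded s ord0.
  by rewrite mid_mapE addn0.
have p1 : p + w <= oadj (darr a) (mid_idx s).+1.
  have /andP[_ +] := mid_bounded s ord_max.
  by rewrite mid_mapE pw.
have p' : oadj (dfst s') (dsrc l') = p.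
  by have := e 0 isT; rewrite !addn0.
have pw' : oadj (dfst s') (dsrc l' + n) = p + w by rewrite -e.
have f := split_factor p0 p1 erefl erefl (esym pw).
have f' := split_factor p0 p1 (esym e1) p' pw'.
rewrite [LHS](congr1 (fun s => midproj s) f) [RHS](congr1 (fun s => midproj s) f').
rewrite [LHS]midproj_post [RHS]midproj_post.
congr (fmap F _ ∘ _); congr conn_hom; apply: oadj_inj => x xn.
by apply: (@addnI p); rewrite !factor_midE ?e.
Qed.

(* Adjoining a new bottom and a new top to [m] makes a map d : [m] -> [n] active,
   hence dual to a map n -> 1 + m + 1. *)
Definition span m n (d : @hom Delta m n) :
  @hom Dmon (conn n) (dsum (conn 1) (dsum (conn m) (conn 1))).
Proof.
refine (@Dhom (conn n) (dsum (conn 1) (dsum (conn m) (conn 1)))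
  (omk (f := fun x => oadj (d : omap _ _) x.+1) _ _) (oconst _) (eq_to_1 _ _)).
- by move=> x xn; rewrite /= add1n addn1 ltnS; apply/oadj_le/ltnW.
- by move=> x y xy _; apply: oadj_mono.
Defined.

Lemma span_map m n (d : @hom Delta m n) : mid_map (span d) = d.
Proof.
apply: omapP => c; apply: ord_inj; rewrite mid_mapE /=.
apply: oadj_eq => x; have [xn|xn] := ltnP x n.
- rewrite oext_mk // add1n ltnS leqNgt -oadjP oext_ord.
  by rewrite ltnS -ltnNge.
- rewrite oext_ge //; have := ltn_ord c; have := ltn_ord ((d : omap _ _) c).
  rewrite /=; lia.
Qed.

Definition from_map m n (d : @hom Delta m n) : @hom N (F (conn n)) (F (conn m)) :=
  midproj (span d).

(** [conn n] has a single target element, so the index is forced and any splitting with the right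
    map can replace [span]. *)
Lemma from_mapE m n l r (s : dhom (conn n) (dsum l (dsum (conn m) r))) :
  midproj s = from_map (mid_map s).
Proof.
apply: midproj_ext; last by rewrite span_map.
by rewrite [LHS]ord1 [RHS]ord1.
Qed.

Lemma subsplit_map a l r l' r' m n (s : dhom a (dsum l (dsum (conn n) r)))
    (s' : dhom (conn n) (dsum l' (dsum (conn m) r'))) :
  mid_map (subsplit s s') = mid_map s ∘ mid_map s'.
Proof.
apply: omapP => c; apply: ord_inj; rewrite mid_mapE.
rewrite [RHS](mid_mapE s) (mid_mapE s').
rewrite /= !oadj_comp !oadj_cast -(addnA (dsrc l) (dsrc l') c) oadj_osum_r.
rewrite oadj_comp oadj_cast !oadj_osum_r oadj_cast oadj_osum_l //.
have := ltn_ord c; rewrite /=; lia.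
Qed.

Lemma subsplit_idx a l r l' r' m n (s : dhom a (dsum l (dsum (conn n) r)))
    (s' : dhom (conn n) (dsum l' (dsum (conn m) r'))) :
  mid_idx (subsplit s s') = mid_idx s.
Proof.
apply: ord_inj; rewrite !mid_idxE /=.
rewrite !oext_comp !oext_cast oext_osum_r oext_comp oext_cast.
rewrite -(ocast_id (erefl (dtgt l'))) osum_cast oext_cast oext_osum_r.
have h : dtgt l' < dtgt l' + (1 + dtgt r') by lia.
rewrite oext_osum_l //; have := oext_lt (dsnd s') h.
by rewrite /= ltnS leqn0 => /eqP ->; rewrite addn0.
Qed.

Lemma from_map_midproj a l r m n (s : dhom a (dsum l (dsum (conn n) r)))
    (d : @hom Delta m n) (l' r' : dob) (t : dhom a (dsum l' (dsum (conn m) r'))) :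
  mid_idx t = mid_idx s -> mid_map t = mid_map s ∘ d ->
  from_map d ∘ midproj s = midproj t.
Proof.
move=> ti tm; rewrite [LHS]midproj_comp; apply: midproj_ext.
- by rewrite [LHS]subsplit_idx ti.
- by rewrite [LHS]subsplit_map span_map tm.
Qed.

(** This is agreement on active maps. Padding [conn n] with zero objects on both sides is a
    splitting whose middle projection is the identity, and precomposing it with g yields a splitting
    that induces [pre g]. *)
Lemma from_map_pre m n (g : omap m n) :
  from_map (pre g) = fmap F (conn_hom g : @hom Dmon _ _).
Proof.
pose s : @hom Dmon (conn n) (dsum dzero (dsum (conn n) dzero)) :=
  bwd (dlunit (dsum (conn n) dzero)) ∘ bwd (drunit (conn n)).
have s1 : midproj s = idm _.
  rewrite /midproj -lock projr_unit projl_unit -!fmapM /s.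
  by rewrite (ccompA (fwd (dlunit _))) bwdK ccomp1m bwdK fmap1.
rewrite -[RHS]ccomp1m -s1 midproj_pre [RHS]from_mapE; congr from_map.
apply: omapP => c; apply: ord_inj; rewrite [LHS]preE [RHS]mid_mapE /=.
by rewrite !oadj_comp !oadj_cast.
Qed.

Lemma from_map_comp m n p (d : @hom Delta n p) (e : @hom Delta m n) :
  from_map (d ∘ e) = from_map e ∘ from_map d.
Proof.
by rewrite [RHS](from_map_midproj (t := span (d ∘ e))) ?span_map.
Qed.

Lemma from_map_id n : from_map (idm (n : Delta)) = idm _.
Proof.
rewrite -pre_id from_map_pre -(fmap1 F); congr fmap.
exact: dhom_ext.
Qed.

Definition from_obj : simplicial C :=
  @Functor (op Delta) C (fun n => F (conn n)) (fun n m d => from_map d)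
    from_map_id (fun _ _ _ g f => from_map_comp f g).

End Projections.

(** * From simplicial objects to monoidal functors *)

Section SumMaps.
Variables m n : nat.

Lemma linc_lt (c : 'I_m.+1) : c < (m + n).+1.
Proof. by have := ltn_ord c; lia. Qed.

Definition linc : @hom Delta m (m + n) :=
  @Omap m.+1 (m + n).+1 (fun c => Ordinal (linc_lt c)) (fun _ _ xy => xy).

Lemma rinc_lt (c : 'I_n.+1) : m + c < (m + n).+1.
Proof. by have := ltn_ord c; lia. Qed.

Definition rinc : @hom Delta n (m + n).
Proof.
by refine (@Omap _ _ (fun c => Ordinal (rinc_lt c)) _) => x y /=; lia.
Defined.

Lemma lret_lt (c : 'I_(m + n).+1) : minn c m < m.+1.
Proof. by lia. Qed.

(** The summand [n] is collapsed to the gluing point m. A map into the interval of a left fibre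
    loses nothing under this retraction, by [linc_lret]. *)
Definition lret : @hom Delta (m + n) m.
Proof.
by refine (@Omap _ _ (fun c => Ordinal (lret_lt c)) _) => x y /=; lia.
Defined.

Lemma rret_lt (c : 'I_(m + n).+1) : c - m < n.+1.
Proof. by have := ltn_ord c; lia. Qed.

Definition rret : @hom Delta (m + n) n.
Proof.
by refine (@Omap _ _ (fun c => Ordinal (rret_lt c)) _) => x y /=; lia.
Defined.

Lemma lret_linc : lret ∘ linc = idm _.
Proof. by apply: omapP => c; apply: ord_inj => /=; have := ltn_ord c; lia. Qed.

Lemma rret_rinc : rret ∘ rinc = idm _.
Proof. by apply: omapP => c; apply: ord_inj => /=; have := ltn_ord c; lia. Qed.
End SumMaps.

Section SumBounded.
Variables (a b : dob).

Lemma oadj_dsum_l (j : 'I_(dtgt a)) :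
  (oadj (darr (dsum a b)) (lshift (dtgt b) j) = oadj (darr a) j) *
  (oadj (darr (dsum a b)) (lshift (dtgt b) j).+1 = oadj (darr a) j.+1).
Proof. by split; rewrite /= oadj_osum_l //; have := ltn_ord j; lia. Qed.

Lemma oadj_dsum_r (j : 'I_(dtgt b)) :
  (oadj (darr (dsum a b)) (rshift (dtgt a) j) = dsrc a + oadj (darr b) j) *
  (oadj (darr (dsum a b)) (rshift (dtgt a) j).+1 = dsrc a + oadj (darr b) j.+1).
Proof. by split; rewrite /= -?addnS oadj_osum_r. Qed.

Lemma bounded_lret (j : 'I_(dtgt a)) n (d : @hom Delta n (dsrc a + dsrc b)) :
  @bounded (dsum a b) (lshift (dtgt b) j) n d ->
  @bounded a j n (lret _ _ ∘ d).
Proof.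
move=> db c; move: (db c); rewrite !oadj_dsum_l.
have := oadj_le (darr a) (ltn_ord j); rewrite /=; lia.
Qed.

Lemma bounded_linc (j : 'I_(dtgt a)) n (d : @hom Delta n (dsrc a)) :
  bounded j d -> @bounded (dsum a b) (lshift (dtgt b) j) n (linc _ _ ∘ d).
Proof.
by move=> db c; rewrite !oadj_dsum_l; apply: db.
Qed.

Lemma linc_lret (j : 'I_(dtgt a)) n (d : @hom Delta n (dsrc a + dsrc b)) :
  @bounded (dsum a b) (lshift (dtgt b) j) n d -> linc _ _ ∘ (lret _ _ ∘ d) = d.
Proof.
move=> db; apply: omapP => c; apply: ord_inj; move: (db c).
rewrite !oadj_dsum_l.
have := oadj_le (darr a) (ltn_ord j); rewrite /=; lia.
Qed.

Lemma bounded_rret (j : 'I_(dtgt b)) n (d : @hom Delta n (dsrc a + dsrc b)) :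
  @bounded (dsum a b) (rshift (dtgt a) j) n d ->
  @bounded b j n (rret _ _ ∘ d).
Proof.
move=> db c; move: (db c); rewrite !oadj_dsum_r /=; lia.
Qed.

Lemma bounded_rinc (j : 'I_(dtgt b)) n (d : @hom Delta n (dsrc b)) :
  bounded j d -> @bounded (dsum a b) (rshift (dtgt a) j) n (rinc _ _ ∘ d).
Proof.
move=> db c; move: (db c); rewrite !oadj_dsum_r /=; lia.
Qed.

Lemma rinc_rret (j : 'I_(dtgt b)) n (d : @hom Delta n (dsrc a + dsrc b)) :
  @bounded (dsum a b) (rshift (dtgt a) j) n d -> rinc _ _ ∘ (rret _ _ ∘ d) = d.
Proof.
move=> db; apply: omapP => c; apply: ord_inj; move: (db c).
rewrite !oadj_dsum_r /=; lia.
Qed.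
End SumBounded.

(** * Products with a prescribed value in the unary case *)

Section ProductOfFamily.
Variable C : cartesian.

(* The product of a family indexed by k, except that for k = 1 it is a
   prescribed object y isomorphic to the single member of the family: the
   functor D -> C must take the value X_n on n -> 1 on the nose. *)
Definition prodob (k : nat) : ('I_k -> C) -> C -> C :=
  match k with
  | 1 => fun _ y => y
  | _ => fun x _ => @bigtens (cart_monoidal C) _ x
  end.

Definition prodproj (k : nat) : forall (x : 'I_k -> C) (y : C),
    (forall i, hom y (x i)) -> forall i, hom (prodob x y) (x i) :=
  match k with
  | 0 => fun x _ _ => @bigproj C 0 x
  | 1 => fun _ _ f => f
  | k'.+2 => fun x _ _ => @bigproj C k'.+2 x
  end.

Definition prodtuple (k : nat) : forall (x : 'I_k -> C) (y c : C),
    (forall i, hom (x i) y) -> (forall i, hom c (x i)) -> hom c (prodob x y) :=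
  match k with
  | 0 => fun x _ c _ h => @bigtuple C c 0 x h
  | 1 => fun _ _ _ g h => g ord0 ∘ h ord0
  | k'.+2 => fun x _ c _ h => @bigtuple C c k'.+2 x h
  end.

Lemma bigproj_ext k (x : 'I_k -> cart_monoidal C) (c : C) (h h' : hom c (bigtens x)) :
  (forall i, bigproj x i ∘ h = bigproj x i ∘ h') -> h = h'.
Proof.
move=> e; rewrite [h]bigtupleP [h']bigtupleP; congr bigtuple.
exact: functional_extensionality_dep.
Qed.

Lemma prodprojP k (x : 'I_k -> C) (y c : C) (f : forall i, hom y (x i))
    (g : forall i, hom (x i) y) (h : forall i, hom c (x i)) i :
  (k = 1 -> forall i, f i ∘ g i = idm _) ->
  prodproj f i ∘ prodtuple g h = h i.
Proof.
case: k x f g h i => [|[|k]] x f g h i fg; [by case: i| |exact: bigprojP].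
by rewrite /= ccompA (ord1 i) fg // ccomp1m.
Qed.

Lemma prodproj_ext k (x : 'I_k -> C) (y c : C) (f : forall i, hom y (x i))
    (g : forall i, hom (x i) y) (h h' : hom c (prodob x y)) :
  (k = 1 -> forall i, g i ∘ f i = idm _) ->
  (forall i, prodproj f i ∘ h = prodproj f i ∘ h') -> h = h'.
Proof.
case: k x f g h h' => [|[|k]] x f g h h' gf e; try exact: bigproj_ext.
by rewrite -[h]ccomp1m -[h']ccomp1m -(gf erefl ord0) -!ccompA [f _ ∘ _]e.
Qed.
End ProductOfFamily.

(** * The functor on D attached to a simplicial object *)

Section ToObj.
Variables (C : cartesian) (X : simplicial C).
Implicit Types a b : dob.
Local Notation Xm d := (fmap X (d : @hom (op Delta) _ _)).

Definition to_ob a : C :=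
  prodob (fun i : 'I_(dtgt a) => fob X (fibre a i)) (fob X (dsrc a)).

Definition to_proj a (i : 'I_(dtgt a)) : hom (to_ob a) (fob X (fibre a i)) :=
  prodproj (fun i => Xm (inert_incl i)) i.

Definition to_tuple a (c : C) (h : forall i : 'I_(dtgt a), hom c (fob X (fibre a i))) :
    hom c (to_ob a) :=
  prodtuple (fun i => Xm (restr i (idm (dsrc a : Delta)))) h.

Lemma to_projP a (c : C) (h : forall i : 'I_(dtgt a), hom c (fob X (fibre a i))) i :
  to_proj i ∘ to_tuple h = h i.
Proof.
apply: prodprojP => _ j; rewrite -fmapM.
rewrite -[_ ∘ _]/(@ccomp Delta _ _ _ (restr j (idm _)) (inert_incl j)).
by rewrite -restr_comp ccomp1m restr_incl fmap1.
Qed.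

Lemma to_proj_ext a (c : C) (h h' : hom c (to_ob a)) :
  (forall i, to_proj i ∘ h = to_proj i ∘ h') -> h = h'.
Proof.
apply: (prodproj_ext (g := fun i => Xm (restr i (idm (dsrc a : Delta))))).
move=> a1 i; rewrite -fmapM.
rewrite -[_ ∘ _]/(@ccomp Delta _ _ _ (inert_incl i) (restr i (idm _))).
rewrite incl_restr ?fmap1 // => c'.
(* For a single target element the fibre interval is all of [m], so the identity is bounded. *)
have i0 : i = 0 :> nat by case: i => i /=; rewrite a1; case: i.
rewrite i0 oadj0 -a1 oadj_top /= -ltnS; exact: ltn_ord.
Qed.

(** Generalizes [to_proj] from the inert inclusion at i to every map bounded at i: fibre sizes are
    often equal without being convertible, and a free source n avoids casts between them. *)
Definition to_at a (i : 'I_(dtgt a)) n (d : @hom Delta n (dsrc a)) :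
  hom (to_ob a) (fob X n) := locked (Xm (restr i d) ∘ to_proj i).

Lemma to_at_comp a i m n (d : @hom Delta n (dsrc a)) (e : @hom Delta m n) :
  Xm e ∘ to_at i d = to_at i (d ∘ e).
Proof. by rewrite /to_at -!lock restr_comp ccompA -fmapM. Qed.

Lemma to_at_incl a (i : 'I_(dtgt a)) : to_at i (inert_incl i) = to_proj i.
Proof. by rewrite /to_at -lock restr_incl [fmap _ _]fmap1 ccomp1m. Qed.

Lemma to_at_conn m n (d : @hom Delta m n) : @to_at (conn n) ord0 m d = Xm d.
Proof.
rewrite /to_at -lock /to_proj /= -fmapM.
rewrite -[_ ∘ _]/(@ccomp Delta _ _ _ (inert_incl _) (restr _ _)).
by rewrite incl_restr //; apply: bounded_conn.
Qed.

Definition to_map a b (t : dhom a b) : hom (to_ob a) (to_ob b) :=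
  to_tuple (fun j => to_at (dsnd t j) (pre (dfst t) ∘ inert_incl j)).

(** [to_map] is given on inert inclusions, and a bounded d factors through one of them. *)
Lemma to_at_map a b (t : dhom a b) j n (d : @hom Delta n (dsrc b)) :
  bounded j d -> to_at j d ∘ to_map t = to_at (dsnd t j) (pre (dfst t) ∘ d).
Proof.
by move=> db; rewrite {1}/to_at -lock -ccompA to_projP to_at_comp -ccompA incl_restr.
Qed.

Lemma to_at_mapA a b (t : dhom a b) j n (d : @hom Delta n (dsrc b))
    (c : C) (h : hom c _) :
  bounded j d ->
  to_at j d ∘ (to_map t ∘ h) = to_at (dsnd t j) (pre (dfst t) ∘ d) ∘ h.
Proof. by move=> db; rewrite ccompA to_at_map. Qed.

Lemma to_at_ext a (c : C) (h h' : hom c (to_ob a)) :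
  (forall i, to_at i (inert_incl i) ∘ h = to_at i (inert_incl i) ∘ h') -> h = h'.
Proof. by move=> e; apply: to_proj_ext => i; rewrite -to_at_incl e. Qed.

Lemma to_map1 a : to_map (did a) = idm _.
Proof.
apply: to_at_ext => i; rewrite to_at_map; last exact: bounded_incl.
by rewrite pre_id ccomp1m ccompm1.
Qed.

Lemma to_mapM a b c (t : dhom b c) (s : dhom a b) :
  to_map (dcomp t s) = to_map t ∘ to_map s.
Proof.
apply: to_at_ext => i; have bi := @bounded_incl _ i.
rewrite to_at_map // to_at_mapA // to_at_map; last exact: bounded_pre.
by rewrite pre_comp ccompA.
Qed.

Definition to_fun : functor Dmon (cart_monoidal C) :=
  @Functor Dmon (cart_monoidal C) to_ob to_map to_map1 (fun _ _ _ t s => to_mapM t s).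

Section Mu.
Variables a b : dob.

(** A fibre of a sum is a fibre of one summand only up to a propositional equality, so its inclusion
    is moved into that summand by a retraction instead of being cast. *)
Definition to_mu_comp (i : 'I_(dtgt a + dtgt b)) :
    hom (cprod (to_ob a) (to_ob b)) (fob X (fibre (dsum a b) i)) :=
  let d := @inert_incl (dsum a b) i in
  match split i with
  | inl j => to_at j (lret _ _ ∘ d) ∘ cfst _ _
  | inr j => to_at j (rret _ _ ∘ d) ∘ csnd _ _
  end.

Definition to_mu_fwd : hom (cprod (to_ob a) (to_ob b)) (to_ob (dsum a b)) :=
  @to_tuple (dsum a b) _ to_mu_comp.

Lemma to_mu_l i (j : 'I_(dtgt a)) n (d : @hom Delta n (dsrc a + dsrc b)) :
  i = lshift (dtgt b) j -> @bounded (dsum a b) i n d ->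
  @to_at (dsum a b) i n d ∘ to_mu_fwd = to_at j (lret _ _ ∘ d) ∘ cfst _ _.
Proof.
move=> -> db; rewrite {1}/to_at -lock -ccompA to_projP /to_mu_comp (unsplitK (inl j)).
by rewrite [LHS]ccompA to_at_comp -ccompA incl_restr.
Qed.

Lemma to_mu_r i (j : 'I_(dtgt b)) n (d : @hom Delta n (dsrc a + dsrc b)) :
  i = rshift (dtgt a) j -> @bounded (dsum a b) i n d ->
  @to_at (dsum a b) i n d ∘ to_mu_fwd = to_at j (rret _ _ ∘ d) ∘ csnd _ _.
Proof.
move=> -> db; rewrite {1}/to_at -lock -ccompA to_projP /to_mu_comp (unsplitK (inr j)).
by rewrite [LHS]ccompA to_at_comp -ccompA incl_restr.
Qed.

Lemma to_mu_lA i (j : 'I_(dtgt a)) n (d : @hom Delta n (dsrc a + dsrc b))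
    (c : C) (h : hom c _) :
  i = lshift (dtgt b) j -> @bounded (dsum a b) i n d ->
  @to_at (dsum a b) i n d ∘ (to_mu_fwd ∘ h)
    = to_at j (lret _ _ ∘ d) ∘ (cfst _ _ ∘ h).
Proof. by move=> ij db; rewrite ccompA (to_mu_l ij) // ccompA. Qed.

Lemma to_mu_rA i (j : 'I_(dtgt b)) n (d : @hom Delta n (dsrc a + dsrc b))
    (c : C) (h : hom c _) :
  i = rshift (dtgt a) j -> @bounded (dsum a b) i n d ->
  @to_at (dsum a b) i n d ∘ (to_mu_fwd ∘ h)
    = to_at j (rret _ _ ∘ d) ∘ (csnd _ _ ∘ h).
Proof. by move=> ij db; rewrite ccompA (to_mu_r ij) // ccompA. Qed.

Definition to_mu_bwd : hom (to_ob (dsum a b)) (cprod (to_ob a) (to_ob b)) :=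
  cpair
    (to_tuple (fun j => @to_at (dsum a b) (lshift _ j) _ (linc _ _ ∘ inert_incl j)))
    (to_tuple (fun j => @to_at (dsum a b) (rshift _ j) _ (rinc _ _ ∘ inert_incl j))).

Lemma to_muV_l (j : 'I_(dtgt a)) n (d : @hom Delta n (dsrc a)) :
  bounded j d -> to_at j d ∘ (cfst _ _ ∘ to_mu_bwd)
    = @to_at (dsum a b) (lshift _ j) n (linc _ _ ∘ d).
Proof.
move=> db; rewrite cfstP {1}/to_at -lock -ccompA to_projP to_at_comp.
by rewrite -ccompA incl_restr.
Qed.

Lemma to_muV_r (j : 'I_(dtgt b)) n (d : @hom Delta n (dsrc b)) :
  bounded j d -> to_at j d ∘ (csnd _ _ ∘ to_mu_bwd)
    = @to_at (dsum a b) (rshift _ j) n (rinc _ _ ∘ d).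
Proof.
move=> db; rewrite csndP {1}/to_at -lock -ccompA to_projP to_at_comp.
by rewrite -ccompA incl_restr.
Qed.

Lemma to_muK : to_mu_bwd ∘ to_mu_fwd = idm _.
Proof.
apply: cpair_ext; apply: to_at_ext => j; have bj := @bounded_incl _ j.
- rewrite ccompm1 (ccompA (cfst _ _)) ccompA to_muV_l //.
  rewrite (to_mu_l erefl); last exact: bounded_linc.
  by rewrite ccompA lret_linc ccomp1m.
- rewrite ccompm1 (ccompA (csnd _ _)) ccompA to_muV_r //.
  rewrite (to_mu_r erefl); last exact: bounded_rinc.
  by rewrite ccompA rret_rinc ccomp1m.
Qed.

Lemma to_muVK : to_mu_fwd ∘ to_mu_bwd = idm _.
Proof.
apply: to_at_ext => i; have bi := @bounded_incl _ i; rewrite ccompm1.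
case: (split_ordP i) => j ij.
- subst i; rewrite (to_mu_lA _ erefl bi).
  by rewrite (to_muV_l (bounded_lret bi)) (linc_lret bi).
- subst i; rewrite (to_mu_rA _ erefl bi).
  by rewrite (to_muV_r (bounded_rret bi)) (rinc_rret bi).
Qed.

Definition to_mu :
  @iso (cart_monoidal C) (cprod (to_ob a) (to_ob b)) (to_ob (dsum a b)) :=
  Iso (to_muK : @ccomp (cart_monoidal C) _ _ _ _ _ = _) to_muVK.
End Mu.
End ToObj.

(** * Naturality and coherence of the product structure *)

Section PreRet.
Variables (m n m' n' : nat) (f : omap m n) (f' : omap m' n').

(** Beyond n both sides are constantly m, since the dual of f preserves the top element. *)
Lemma pre_lret : pre f ∘ lret n n' = lret m m' ∘ pre (osum f f').
Proof.
apply: omapP => c; apply: ord_inj; rewrite [LHS]preE.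
rewrite -[RHS]/(minn (pre (osum f f') c) m) preE oadj_osum /=.
case: ifP => cn.
- by have := oadj_le f cn; rewrite (minn_idPl cn); lia.
- by rewrite (minn_idPr _) ?oadj_top; lia.
Qed.

Lemma pre_rret : pre f' ∘ rret n n' = rret m m' ∘ pre (osum f f').
Proof.
apply: omapP => c; apply: ord_inj; rewrite [LHS]preE.
rewrite -[RHS]/(pre (osum f f') c - m) preE oadj_osum /=.
case: ifP => cn; last lia.
have -> : c - n = 0 by lia.
by rewrite oadj0; have := oadj_le f cn; lia.
Qed.
End PreRet.

Section ToMonfunctor.
Variables (C : cartesian) (X : simplicial C).
Local Notation N := (cart_monoidal C).

Lemma to_at_eq a (i j : 'I_(dtgt a)) n (d e : @hom Delta n (dsrc a)) :
  i = j -> d = e -> to_at X i d = to_at X j e.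
Proof. by move=> -> ->. Qed.

Lemma to_mu_nat (a b a' b' : Dmon) (f : hom a a') (g : hom b b') :
  fwd (to_mu X a' b') ∘ ((to_map X f : @hom N _ _) ⊗₁ (to_map X g : @hom N _ _))
    = (to_map X (f ⊗₁ g) : @hom N _ _) ∘ fwd (to_mu X a b).
Proof.
apply: to_at_ext => i; have bi := @bounded_incl _ i.
rewrite [RHS]ccompA [in RHS]to_at_map //.
case: (split_ordP i) => j ij.
- rewrite [LHS](to_mu_lA _ ij bi) [cfst _ _ ∘ _]tens_fst [LHS]to_at_mapA; last first.
    by apply: bounded_lret; rewrite -ij.
  rewrite [RHS](to_mu_l X (j := dsnd f j)); last exact: bounded_pre.
  - by rewrite !ccompA (pre_lret _ (dfst g)).
  - by rewrite ij; apply: osum_lshift.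
- rewrite [LHS](to_mu_rA _ ij bi) [csnd _ _ ∘ _]tens_snd [LHS]to_at_mapA; last first.
    by apply: bounded_rret; rewrite -ij.
  rewrite [RHS](to_mu_r X (j := dsnd g j)); last exact: bounded_pre.
  - by rewrite !ccompA (pre_rret (dfst f)).
  - by rewrite ij; apply: osum_rshift.
Qed.

(** The associator only relabels indices. In each of the three cases for i both sides are the same
    component, taken at iterated retractions of one map d, and these agree as maps on numbers. *)
Lemma to_muA (a b c : Dmon) :
  (to_map X (fwd (massoc a b c)) : @hom N _ _) ∘
    (fwd (to_mu X (a ⊗ b) c) ∘ (fwd (to_mu X a b) ⊗₁ @idm N (to_ob X c)))
  = (fwd (to_mu X a (b ⊗ c)) ∘
      ((@idm N (to_ob X a) ⊗₁ fwd (to_mu X b c)) ∘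
        fwd (@massoc N (to_ob X a) (to_ob X b) (to_ob X c)))).
Proof.
apply: to_at_ext => i; have := @bounded_incl _ i.
(* The inert inclusion is generalized to a bounded d, so that i can be rewritten without touching
   its source. *)
move: (fibre _ _) (inert_incl i) => n d bd.
have := bounded_pre (fwd (massoc a b c)) bd.
rewrite [LHS]to_at_mapA // [dfst _]/= pre_cast.
case: (split_ordP i) => [j|j'] ij; last case: (split_ordP j') => j j'j.
- have e : dsnd (fwd (massoc a b c)) i = lshift (dtgt c) (lshift (dtgt b) j).
    by apply: ord_inj; rewrite ij.
  rewrite e => b1; have b2 := bounded_lret b1.
  rewrite [LHS](to_mu_lA _ erefl b1) tens_fst.
  rewrite [LHS](to_mu_lA _ erefl b2) [RHS](to_mu_lA _ ij bd).
  rewrite tens_fstA ccomp1m assoc_fst; congr (_ ∘ _); apply: to_at_eq => //.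
  by apply: omapP => x; apply: ord_inj => /=; lia.
- subst j'.
  have e : dsnd (fwd (massoc a b c)) i = lshift (dtgt c) (rshift (dtgt a) j).
    by apply: ord_inj; rewrite ij.
  rewrite e => b1; have b2 := bounded_lret b1.
  rewrite [LHS](to_mu_lA _ erefl b1) tens_fst.
  rewrite [LHS](to_mu_rA _ erefl b2) [RHS](to_mu_rA _ ij bd).
  rewrite ij in bd; have b3 := bounded_rret bd.
  rewrite tens_sndA [RHS](to_mu_lA _ erefl b3) assoc_snd_fst.
  congr (_ ∘ _); apply: to_at_eq => //.
  by apply: omapP => x; apply: ord_inj => /=; lia.
- subst j'.
  have e : dsnd (fwd (massoc a b c)) i = rshift (dtgt (a ⊗ b)) j.
    by apply: ord_inj; rewrite ij /= addnA.
  rewrite e => b1.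
  rewrite [LHS](to_mu_rA _ erefl b1) tens_snd ccomp1m [RHS](to_mu_rA _ ij bd).
  rewrite ij in bd; have b3 := bounded_rret bd.
  rewrite tens_sndA [RHS](to_mu_rA _ erefl b3) assoc_snd_snd.
  congr (_ ∘ _); apply: to_at_eq => //.
  by apply: omapP => x; apply: ord_inj => /=; lia.
Qed.

Lemma to_mu1l (a : Dmon) :
  (to_map X (fwd (mlunit a)) : @hom N _ _) ∘
    (fwd (to_mu X dzero a) ∘ (@idm N cterm ⊗₁ @idm N (to_ob X a)))
  = fwd (@mlunit N (to_ob X a)).
Proof.
apply: to_at_ext => i; have bd := @bounded_incl _ i.
rewrite [LHS]to_at_mapA // [dfst _]/= pre_cast.
have e : dsnd (fwd (mlunit a)) i = rshift 0 i by apply: ord_inj.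
rewrite tens1 ccompm1 [LHS](to_mu_r _ e).
  congr (_ ∘ _); apply: to_at_eq => //.
  by apply: omapP => x; apply: ord_inj; rewrite /= subn0.
by rewrite -pre_cast; apply: (bounded_pre (fwd (mlunit a))).
Qed.

Lemma to_mu1r (a : Dmon) :
  (to_map X (fwd (mrunit a)) : @hom N _ _) ∘
    (fwd (to_mu X a dzero) ∘ (@idm N (to_ob X a) ⊗₁ @idm N cterm))
  = fwd (@mrunit N (to_ob X a)).
Proof.
apply: to_at_ext => i; have bd := @bounded_incl _ i.
rewrite [LHS]to_at_mapA // [dfst _]/= pre_cast.
have e : dsnd (fwd (mrunit a)) i = lshift 0 i by apply: ord_inj.
rewrite tens1 ccompm1 [LHS](to_mu_l _ e).
  congr (_ ∘ _); apply: to_at_eq => //.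
  apply: omapP => x; apply: ord_inj.
  have := ltn_ord ((inert_incl i : omap _ _) x).
  move: (inert_incl i) => d /=; rewrite ltnS => /minn_idPl; exact.
by rewrite -pre_cast; apply: (bounded_pre (fwd (mrunit a))).
Qed.

(** The value at the zero object is the empty product, which is [cterm] by computation. *)
Definition to_eps : @iso N munit (to_ob X dzero) :=
  @Iso N cterm cterm (idm _) (idm _) (ccomp1m _) (ccomp1m _).

Definition to_obj : dmonfun C :=
  @Monfunctor Dmon N (to_fun X) (to_mu X) to_eps
    (fun a b a' b' f g => @to_mu_nat a b a' b' f g) to_muA to_mu1l to_mu1r.

End ToMonfunctor.

(** * Monoidal transformations from simplicial maps *)

Section ToMor.
Variables (C : cartesian) (X Y : simplicial C) (s : @hom (simplicial C) X Y).

Definition to_nt_comp (a : dob) : hom (to_ob X a) (to_ob Y a) :=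
  to_tuple (fun i => nt s (fibre a i) ∘ to_proj X i).

Lemma to_at_nt a (i : 'I_(dtgt a)) n (d : @hom Delta n (dsrc a)) :
  bounded i d -> to_at Y i d ∘ to_nt_comp a = nt s n ∘ to_at X i d.
Proof.
by move=> db; rewrite /to_at -!lock -ccompA to_projP !ccompA (ntP s).
Qed.

Lemma to_at_ntA a (i : 'I_(dtgt a)) n (d : @hom Delta n (dsrc a)) (c : C) (h : hom c _) :
  bounded i d -> to_at Y i d ∘ (to_nt_comp a ∘ h) = nt s n ∘ (to_at X i d ∘ h).
Proof. by move=> db; rewrite !ccompA to_at_nt. Qed.

Lemma to_nt_nat (a b : Dmon) (f : hom a b) :
  to_nt_comp b ∘ to_map X f = to_map Y f ∘ to_nt_comp a.
Proof.
apply: to_at_ext => i; have bi := @bounded_incl _ i.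
rewrite to_at_ntA // to_at_map // to_at_mapA // to_at_nt //.
exact: bounded_pre.
Qed.

Definition to_nt : nattrans (to_fun X) (to_fun Y) :=
  @Nattrans Dmon (cart_monoidal C) (to_fun X) (to_fun Y) to_nt_comp to_nt_nat.

Lemma to_nt_mu (a b : Dmon) :
  to_nt (a ⊗ b) ∘ fwd (to_mu X a b) = fwd (to_mu Y a b) ∘ (to_nt a ⊗₁ to_nt b).
Proof.
apply: to_at_ext => i; have bi := @bounded_incl _ i.
rewrite [LHS]to_at_ntA //.
case: (split_ordP i) => j ij.
- rewrite [in LHS](to_mu_l X ij bi) [RHS](to_mu_lA _ ij bi) tens_fst.
  rewrite ij in bi *; exact: (esym (to_at_ntA _ (bounded_lret bi))).
- rewrite [in LHS](to_mu_r X ij bi) [RHS](to_mu_rA _ ij bi) tens_snd.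
  rewrite ij in bi *; exact: (esym (to_at_ntA _ (bounded_rret bi))).
Qed.

Definition to_mor : @hom (dmonfun C) (to_obj X) (to_obj Y) :=
  @Monnattrans Dmon (cart_monoidal C) (to_obj X) (to_obj Y) to_nt to_nt_mu
    (cbang_ext _ _).

End ToMor.

(** * Components of a monoidal functor at the fibres *)

Lemma mid_map_pre a b l r n (s : dhom b (dsum l (dsum (conn n) r))) (t : dhom a b) :
  mid_map (dcomp s t) = pre (dfst t) ∘ mid_map s.
Proof. by rewrite /mid_map pre_comp -ccompA. Qed.

Section Pieces.
Variables (C : cartesian) (F : monfunctor Dmon (cart_monoidal C)).
Local Notation N := (cart_monoidal C).
Implicit Types a b : dob.

Lemma piece_le a (i : 'I_(dtgt a)) :
  oadj (darr a) i + fibre a i <= oadj (darr a) i.+1.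
Proof. by rewrite oadj_fibre. Qed.

(** The window is the whole fibre over i, so the induced map is the inert inclusion. *)
Definition piece_split a (i : 'I_(dtgt a)) := split_mid (leqnn _) (piece_le i).

Definition piece a (i : 'I_(dtgt a)) : @hom N (F a) (F (conn (fibre a i))) :=
  midproj F (piece_split i).

(** Counterpart of [to_at] for F. Both obey the same rules, which makes the comparison map between F
    and [to_obj (from_obj F)] natural and monoidal. *)
Definition from_at a (i : 'I_(dtgt a)) n (d : @hom Delta n (dsrc a)) :
  @hom N (F a) (F (conn n)) := locked (from_map F (restr i d) ∘ piece i).

Lemma from_at_eq a (i j : 'I_(dtgt a)) n (d e : @hom Delta n (dsrc a)) :
  i = j -> d = e -> from_at i d = from_at j e.
Proof. by move=> -> ->. Qed.

Lemma piece_map a (i : 'I_(dtgt a)) : mid_map (piece_split i) = inert_incl i.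
Proof.
by apply: omapP => c; apply: ord_inj; rewrite [LHS]split_mapE inert_inclE.
Qed.

(** The map induced by s is bounded, so it factors through the inclusion of the fibre, and the
    middle projection factors accordingly through [piece]. *)
Lemma from_at_mid a l r n (s : dhom a (dsum l (dsum (conn n) r))) :
  midproj F s = from_at (mid_idx s) (mid_map s).
Proof.
rewrite /from_at -lock /piece; apply/esym/from_map_midproj.
- by rewrite split_idx.
- by rewrite piece_map incl_restr //; apply: mid_bounded.
Qed.

Lemma from_at_comp a (i : 'I_(dtgt a)) m n (d : @hom Delta n (dsrc a))
    (e : @hom Delta m n) :
  from_map F e ∘ from_at i d = from_at i (d ∘ e).
Proof. by rewrite /from_at -!lock restr_comp from_map_comp ccompA. Qed.

Lemma from_at_incl a (i : 'I_(dtgt a)) : from_at i (inert_incl i) = piece i.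
Proof. by rewrite /from_at -lock restr_incl from_map_id ccomp1m. Qed.

Lemma from_at_piece a (i : 'I_(dtgt a)) n (d : @hom Delta n (dsrc a)) :
  from_at i d = from_map F (restr i d) ∘ piece i.
Proof. by rewrite /from_at -lock. Qed.

Lemma from_at_conn m n (d : @hom Delta m n) : @from_at (conn n) ord0 m d = from_map F d.
Proof.
rewrite -[in RHS](span_map d) -[RHS]from_mapE [RHS]from_at_mid.
by apply: from_at_eq; rewrite ?span_map // [RHS]ord1.
Qed.

Lemma from_at_map a b (t : @hom Dmon a b) j n (d : @hom Delta n (dsrc b)) :
  bounded j d -> from_at j d ∘ fmap F t = from_at (dsnd t j) (pre (dfst t) ∘ d).
Proof.
move=> db; rewrite from_at_piece -ccompA midproj_pre.
rewrite [midproj F _]from_at_mid mid_map_pre piece_map.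
have -> : mid_idx (dcomp (piece_split j) t) = dsnd t j.
  by rewrite -[in RHS](split_idx (leqnn _) (piece_le j)).
by rewrite from_at_comp -ccompA incl_restr.
Qed.

Section Proj.
Variables a b : dob.

Lemma midproj_projl l r n (s : @hom Dmon a (dsum l (dsum (conn n) r))) :
  midproj F s ∘ projl F a b
  = @from_at (dsum a b) (lshift _ (mid_idx s)) _ (linc _ _ ∘ mid_map s).
Proof.
(* A splitting of a becomes one of a + b when b is absorbed into the right outer summand. *)
pose s' : @hom Dmon (dsum a b) (dsum l (dsum (conn n) (dsum r b))) :=
  (@idm Dmon l ⊗₁ fwd (@massoc Dmon (conn n) r b)) ∘
    (fwd (@massoc Dmon l (dsum (conn n) r) b) ∘ (s ⊗₁ @idm Dmon b)).
have -> : midproj F s ∘ projl F a b = midproj F s'.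
  rewrite /midproj -!lock /s' !fmapM projr_natA projl_assocA projlr_assocA.
  by rewrite projl_nat -!ccompA.
rewrite from_at_mid; apply: from_at_eq.
- apply: ord_inj; rewrite mid_idxE /= !oext_comp oext_cast.
  rewrite -(ocast_id (erefl (dtgt l))) osum_cast oext_cast mid_idxE.
  by rewrite oext_osum_l //; lia.
- apply: omapP => c; apply: ord_inj; rewrite mid_mapE [RHS]mid_mapE.
  rewrite /= !oadj_comp oadj_cast oadj_osum_r oadj_cast oadj_osum_l //.
  by have := ltn_ord c; rewrite /=; lia.
Qed.

Lemma midproj_projr l r n (s : @hom Dmon b (dsum l (dsum (conn n) r))) :
  midproj F s ∘ projr F a b
  = @from_at (dsum a b) (rshift _ (mid_idx s)) _ (rinc _ _ ∘ mid_map s).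
Proof.
pose s' : @hom Dmon (dsum a b) (dsum (dsum a l) (dsum (conn n) r)) :=
  bwd (@massoc Dmon a l (dsum (conn n) r)) ∘ (@idm Dmon a ⊗₁ s).
have -> : midproj F s ∘ projr F a b = midproj F s'.
  rewrite /midproj -!lock /s' !fmapM projr_assocVA.
  by rewrite projr_nat -!ccompA.
rewrite from_at_mid; apply: from_at_eq.
- apply: ord_inj; rewrite mid_idxE /= !oext_comp oext_cast mid_idxE.
  by rewrite oext_osum_r.
- apply: omapP => c; apply: ord_inj; rewrite mid_mapE.
  rewrite -[RHS]/(dsrc a + (mid_map s : omap _ _) c) mid_mapE.
  by rewrite /= !oadj_comp oadj_cast -addnA oadj_osum_r.
Qed.

Lemma from_at_projl (j : 'I_(dtgt a)) n (d : @hom Delta n (dsrc a)) : bounded j d ->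
  from_at j d ∘ projl F a b = @from_at (dsum a b) (lshift _ j) _ (linc _ _ ∘ d).
Proof.
move=> db; rewrite from_at_piece -ccompA midproj_projl from_at_comp.
by rewrite split_idx piece_map -ccompA incl_restr.
Qed.

Lemma from_at_projr (j : 'I_(dtgt b)) n (d : @hom Delta n (dsrc b)) : bounded j d ->
  from_at j d ∘ projr F a b = @from_at (dsum a b) (rshift _ j) _ (rinc _ _ ∘ d).
Proof.
move=> db; rewrite from_at_piece -ccompA midproj_projr from_at_comp.
by rewrite split_idx piece_map -ccompA incl_restr.
Qed.
End Proj.

Definition unit_nt_comp a : hom (F a) (to_ob (from_obj F) a) :=
  to_tuple (X := from_obj F) (@piece a).

Lemma to_at_unit a (i : 'I_(dtgt a)) n (d : @hom Delta n (dsrc a)) :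
  to_at (from_obj F) i d ∘ unit_nt_comp a = from_at i d.
Proof. by rewrite from_at_piece {1}/to_at -lock -ccompA to_projP. Qed.

Lemma unit_nt_nat a b (t : @hom Dmon a b) :
  unit_nt_comp b ∘ fmap F t = to_map (from_obj F) t ∘ unit_nt_comp a.
Proof.
apply: to_at_ext => i; have bi := @bounded_incl _ i.
rewrite [LHS]ccompA to_at_unit to_at_mapA // to_at_unit; exact: from_at_map.
Qed.

Lemma unit_nt_mu a b :
  unit_nt_comp (dsum a b) ∘ fwd (mmu F a b)
  = fwd (to_mu (from_obj F) a b) ∘
    ((unit_nt_comp a : @hom N _ _) ⊗₁ (unit_nt_comp b : @hom N _ _)).
Proof.
apply: to_at_ext => i; have bi := @bounded_incl _ i.
rewrite [LHS]ccompA to_at_unit.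
case: (split_ordP i) => j ij.
- rewrite [RHS](to_mu_lA _ ij bi) tens_fst [RHS]ccompA to_at_unit -projl_mu.
  rewrite [RHS]ccompA; congr (_ ∘ _).
  rewrite ij in bi *; rewrite from_at_projl; last exact: bounded_lret bi.
  by rewrite (linc_lret bi).
- rewrite [RHS](to_mu_rA _ ij bi) tens_snd [RHS]ccompA to_at_unit -projr_mu.
  rewrite [RHS]ccompA; congr (_ ∘ _).
  rewrite ij in bi *; rewrite from_at_projr; last exact: bounded_rret bi.
  by rewrite (rinc_rret bi).
Qed.

Definition unit_mor : @hom (dmonfun C) F (to_obj (from_obj F)) :=
  @Monnattrans Dmon N F (to_obj (from_obj F))
    (@Nattrans Dmon N F (to_fun (from_obj F)) unit_nt_comp unit_nt_nat)
    unit_nt_mu (cbang_ext _ _).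

End Pieces.

(** * The equivalence *)

Section Decomposition.
Variables (C : cartesian) (F : monfunctor Dmon (cart_monoidal C)).
Local Notation N := (cart_monoidal C).

Fixpoint mcomp (k : nat) : forall x : 'I_k -> Dmon,
    @hom N (bigtens (fun i => F (x i))) (F (bigtens x)) :=
  match k with
  | 0 => fun _ => fwd (meps F)
  | k'.+1 => fun x =>
      fwd (mmu F _ _) ∘ (idm _ ⊗₁ mcomp (fun i => x (lift ord0 i)))
  end.

Lemma mdecompS k (x : 'I_k.+1 -> Dmon) :
  mdecomp F x = (@idm N (F (x ord0)) ⊗₁ mdecomp F (fun i => x (lift ord0 i))) ∘
                bwd (mmu F (x ord0) (bigtens (fun i => x (lift ord0 i)))).
Proof. by []. Qed.

Lemma mcompS k (x : 'I_k.+1 -> Dmon) :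
  mcomp x = fwd (mmu F (x ord0) (bigtens (fun i => x (lift ord0 i)))) ∘
            (@idm N (F (x ord0)) ⊗₁ mcomp (fun i => x (lift ord0 i))).
Proof. by []. Qed.

Lemma mdecompK k (x : 'I_k -> Dmon) : mcomp x ∘ mdecomp F x = idm _.
Proof.
elim: k x => [|k IH] x; first exact: bwdK.
rewrite mdecompS mcompS -ccompA (ccompA (_ ⊗₁ _)) -tensM IH ccomp1m tens1 ccomp1m.
exact: bwdK.
Qed.

Lemma mcompK k (x : 'I_k -> Dmon) : mdecomp F x ∘ mcomp x = idm _.
Proof.
elim: k x => [|k IH] x; first exact: fwdK.
rewrite mdecompS mcompS -ccompA (ccompA (bwd _)) fwdK ccomp1m -tensM IH ccomp1m.
exact: tens1.
Qed.

Lemma projl_conn n b :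
  projl F (conn n) b
  = @from_at _ F (dsum (conn n) b) (lshift _ ord0) n (linc n (dsrc b)).
Proof.
have h : @bounded (conn n) ord0 n (idm (n : Delta)) := @bounded_conn _ _ _.
by rewrite -[LHS]ccomp1m -(from_map_id F) -from_at_conn from_at_projl.
Qed.

Lemma oadj_ext_sum k (p : 'I_k -> nat) (j : 'I_(dtgt (ext_sum p))) (i : 'I_k) :
  j = i :> nat ->
  oadj (darr (ext_sum p)) j.+1 = oadj (darr (ext_sum p)) j + p i.
Proof.
move=> ji; rewrite -(fibre_ext_sum p i) oadj_fibre; congr (_ + fibre _ _).
exact: ord_inj.
Qed.

(** Induction on k: the head is a left projection, computed by [projl_conn], and the tail follows a
    right projection, which shifts positions by [p ord0]. The index j and the map d are specified by
    their values because [dtgt (ext_sum p)] equals k only propositionally. *)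
Lemma mdecomp_at k (p : 'I_k -> nat) (i : 'I_k) (j : 'I_(dtgt (ext_sum p)))
    (d : @hom Delta (p i) (dsrc (ext_sum p))) :
  j = i :> nat ->
  (forall c, (d : omap _ _) c = oadj (darr (ext_sum p)) i + c :> nat) ->
  bigproj _ i ∘ mdecomp F (fun i => conn (p i)) = from_at F j d.
Proof.
elim: k p i j d => [|k IH] p i; first by case: i.
case: (unliftP ord0 i) => [i'|] -> j d ji dE; rewrite mdecompS.
- pose q i := p (lift ord0 i).
  have [j' jj'] : exists j' : 'I_(dtgt (ext_sum q)), j = rshift 1 j'.
    case: (split_ordP j) => [j'|j'] e; last by exists j'.
    by move: ji; rewrite e /= (ord1 j').
  have ij' : j' = i' :> nat by move: ji; rewrite jj' /= => -[].
  have oE : oadj (darr (ext_sum p)) (lift ord0 i')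
            = p ord0 + oadj (darr (ext_sum q)) i'.
    exact: (oadj_osum_r (oconst (p ord0)) (darr (ext_sum q))).
  pose d' : @hom Delta (q i') (dsrc (ext_sum q)) := rret (p ord0) _ ∘ d.
  have d'E c : (d' : omap _ _) c = oadj (darr (ext_sum q)) i' + c :> nat.
    by rewrite -[LHS]/((d : omap _ _) c - p ord0) dE oE -addnA addKn.
  have dd' : d = rinc _ _ ∘ d'.
    apply: omapP => c; apply: ord_inj.
    by rewrite -[RHS]/(p ord0 + (d' : omap _ _) c) dE oE d'E addnA.
  have bd' : @bounded (ext_sum q) j' _ d'.
    move=> c; rewrite d'E (oadj_ext_sum ij') ij'; have := ltn_ord c; lia.
  rewrite /= ord_caseS -!ccompA [csnd _ _ ∘ (_ ∘ _)]tens_sndA.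
  rewrite [LHS]ccompA [bigproj _ _ ∘ _](IH q i' j' d' ij' d'E).
  rewrite -[csnd _ _ ∘ _]projrE from_at_projr //.
  by apply: from_at_eq.
- rewrite /= ord_case0 ccompA [cfst _ _ ∘ _]tens_fst ccomp1m.
  rewrite -[cfst _ _ ∘ _]projlE [LHS]projl_conn.
  apply: from_at_eq; first exact: ord_inj.
  by apply: omapP => c; apply: ord_inj; rewrite dE oadj0.
Qed.

End Decomposition.

Lemma oadj_dfst_eq (a b : Dcat) (e : a = b) c : oadj (dfst (eq_hom e)) c = c.
Proof. by case: b / e; apply: oadj_id. Qed.

Lemma dsnd_eq (a b : Dcat) (e : a = b) j : dsnd (eq_hom e) j = j :> nat.
Proof. by case: b / e j. Qed.

(** * The value of F as the product of its pieces *)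

Section Counit.
Variables (C : cartesian) (F : monfunctor Dmon (cart_monoidal C)).
Local Notation N := (cart_monoidal C).

Definition decomp (a : Dmon) : @hom N (F a) (bigtens (fun i => F (conn (fibre a i)))) :=
  mdecomp F (fun i => conn (fibre a i)) ∘ fmap F (eq_hom (ext_sum_decomp a)).

(** The equality of a with the sum of its fibres moves no position and no index, so the component
    given by [mdecomp_at] is the one at the inert inclusion of a itself. *)
Lemma decomp_piece (a : Dmon) i : bigproj _ i ∘ decomp a = piece F i.
Proof.
have ea c : oadj (darr (ext_sum (fibre a))) c = oadj (darr a) c.
  exact: (congr1 (fun b : dob => oadj (darr b) c) (esym (ext_sum_decomp a))).
pose j := cast_ord (esym (dtgt_ext_sum (fibre a))) i.
have e : (dsrc a).+1 = (dsrc (ext_sum (fibre a))).+1.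
  exact: (congr1 (fun b : dob => (dsrc b).+1) (ext_sum_decomp a)).
pose d : @hom Delta (fibre a i) (dsrc (ext_sum (fibre a))) :=
  ocomp (ocast e) (inert_incl i).
have dE c : (d : omap _ _) c = oadj (darr (ext_sum (fibre a))) i + c :> nat.
  by rewrite ea -inert_inclE.
have bd : bounded j d.
  move=> c; rewrite dE (@oadj_ext_sum _ _ j i) //= leq_addr leq_add2l -ltnS.
  exact: ltn_ord.
rewrite /decomp [LHS]ccompA (@mdecomp_at _ _ _ _ i j d) // [LHS]from_at_map //.
rewrite -from_at_incl; apply: from_at_eq.
- by apply: ord_inj; rewrite dsnd_eq.
- apply: omapP => c; apply: ord_inj.
  by rewrite -[LHS]/(nat_of_ord (pre _ (d c))) preE oadj_dfst_eq.
Qed.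

Definition recomp (a : Dmon) : @hom N (bigtens (fun i => F (conn (fibre a i)))) (F a) :=
  fmap F (eq_hom (esym (ext_sum_decomp a))) ∘ mcomp F (fun i => conn (fibre a i)).

Lemma decompK a : recomp a ∘ decomp a = idm _.
Proof.
rewrite /recomp /decomp -ccompA (ccompA (mcomp _ _)) mdecompK ccomp1m -fmapM.
by rewrite eq_homK fmap1.
Qed.

Lemma recompK a : decomp a ∘ recomp a = idm _.
Proof.
rewrite /recomp /decomp -ccompA (ccompA (fmap F _)) -fmapM eq_homVK fmap1 ccomp1m.
exact: mcompK.
Qed.

(** The pieces are the coordinates of the isomorphism [decomp a] onto a product. *)
Lemma piece_ext (a : Dmon) (c : N) (h h' : hom c (F a)) :
  (forall i, piece F i ∘ h = piece F i ∘ h') -> h = h'.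
Proof.
move=> e; have {}e : decomp a ∘ h = decomp a ∘ h'.
  apply: (@bigproj_ext C) => i.
  by rewrite [LHS]ccompA [RHS]ccompA [bigproj _ _ ∘ _]decomp_piece.
by rewrite -[h]ccomp1m -[h']ccomp1m -decompK -[LHS]ccompA e -[RHS]ccompA.
Qed.

Definition counit_comp (a : Dmon) : @hom N (to_ob (from_obj F) a) (F a) :=
  recomp a ∘ bigtuple (to_proj (from_obj F) (a := a)).

Lemma piece_counit (a : Dmon) i :
  piece F i ∘ counit_comp a = to_proj (from_obj F) i.
Proof.
rewrite -decomp_piece /counit_comp -ccompA (ccompA (decomp a)) recompK ccomp1m.
exact: bigprojP.
Qed.

Lemma to_proj_unit (a : Dmon) i :
  to_proj (from_obj F) i ∘ unit_nt_comp F a = piece F i.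
Proof. exact: to_projP. Qed.

Lemma unitK a : counit_comp a ∘ unit_nt_comp F a = idm _.
Proof.
apply: piece_ext => i.
by rewrite [LHS]ccompA piece_counit [RHS]ccompm1; apply: to_proj_unit.
Qed.

Lemma counitK a : unit_nt_comp F a ∘ counit_comp a = idm _.
Proof.
apply: to_proj_ext => i.
by rewrite [LHS]ccompA to_proj_unit ccompm1 [LHS]piece_counit.
Qed.

End Counit.

(** * Pointwise inverses of monoidal transformations *)

Section MonoidalInverse.
Variables (M N : monoidal) (F G : monfunctor M N) (t : monnattrans F G).
Variable t' : forall a, hom (G a) (F a).
Hypothesis tK : forall a, t' a ∘ t a = idm _.
Hypothesis t'K : forall a, t a ∘ t' a = idm _.

Lemma inverse_nat a b (f : hom a b) : t' b ∘ fmap G f = fmap F f ∘ t' a.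
Proof.
rewrite -[LHS]ccompm1 -(t'K a) -ccompA (ccompA (fmap G f)) -ntP -ccompA.
by rewrite !ccompA tK ccomp1m.
Qed.

Definition inverse_nt : nattrans G F := Nattrans inverse_nat.

Lemma inverse_mu a b :
  inverse_nt (a ⊗ b) ∘ fwd (mmu G a b)
  = fwd (mmu F a b) ∘ (inverse_nt a ⊗₁ inverse_nt b).
Proof.
rewrite -[LHS]ccompm1 -tens1 -(t'K a) -(t'K b) tensM.
rewrite -ccompA (ccompA (fwd (mmu G a b))) -mnt_mu !ccompA /=.
by rewrite tK ccomp1m.
Qed.

Lemma inverse_eps : inverse_nt munit ∘ fwd (meps G) = fwd (meps F).
Proof. by rewrite -(mnt_eps t) ccompA /= tK ccomp1m. Qed.

Definition inverse_mnt : monnattrans G F := Monnattrans inverse_mu inverse_eps.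

Definition inverse_iso : @iso (monfun_cat M N) F G :=
  @Iso (monfun_cat M N) F G t inverse_mnt
    (monnattrans_eq (s := mnt_comp inverse_mnt t) (t := mnt_id F) tK)
    (monnattrans_eq (s := mnt_comp t inverse_mnt) (t := mnt_id G) t'K).

End MonoidalInverse.

(** * Simplicial maps from monoidal transformations *)

Section FromMor.
Variables (C : cartesian) (F G : dmonfun C) (t : @hom (dmonfun C) F G).
Local Notation N := (cart_monoidal C).

Lemma projl_nt (a b : Dmon) :
  projl G a b ∘ mnt t (dsum a b) = mnt t a ∘ projl F a b.
Proof.
apply: (iso_epi (f := mmu F a b)).
by rewrite -!ccompA [mnt t (dsum a b) ∘ _](mnt_mu t) !projE.
Qed.

Lemma projr_nt (a b : Dmon) :
  projr G a b ∘ mnt t (dsum a b) = mnt t b ∘ projr F a b.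
Proof.
apply: (iso_epi (f := mmu F a b)).
by rewrite -!ccompA [mnt t (dsum a b) ∘ _](mnt_mu t) !projE.
Qed.

Lemma midproj_nt (a l c r : Dmon) (s : @hom Dmon a (dsum l (dsum c r))) :
  midproj G s ∘ mnt t a = mnt t c ∘ midproj F s.
Proof.
rewrite /midproj -!lock -!ccompA -ntP (ccompA (projr _ _ _)) projr_nt.
by rewrite !ccompA projl_nt.
Qed.

Definition from_mor : @hom (simplicial C) (from_obj F) (from_obj G) :=
  @Nattrans (op Delta) C (from_obj F) (from_obj G) (fun n => mnt t (conn n))
    (fun m n d => esym (midproj_nt (span d))).

Lemma piece_nt (a : Dmon) (i : 'I_(dtgt a)) :
  piece G i ∘ mnt t a = mnt t (conn (fibre a i)) ∘ piece F i.
Proof. exact: midproj_nt. Qed.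

End FromMor.

(** * Round trips on connected objects *)

Section ToFrom.
Variables (C : cartesian).
Local Notation N := (cart_monoidal C).

(** The two projections of [to_obj X] act on components through [linc] and [rinc], whose composite
    is the inclusion of the middle summand; [to_at_map] then adds the dual of [dfst s]. *)
Lemma to_midproj (X : simplicial C) (a l r : Dmon) n
    (s : @hom Dmon a (dsum l (dsum (conn n) r))) :
  midproj (to_obj X) s = to_at X (mid_idx s) (mid_map s).
Proof.
have L x y (j : 'I_(dtgt x)) m (d : @hom Delta m (dsrc x)) : bounded j d ->
    to_at X j d ∘ projl (to_obj X) x y
      = @to_at _ X (dsum x y) (lshift _ j) m (linc _ _ ∘ d).
  by move=> bd; rewrite projlE; apply: to_muV_l.
have R x y (j : 'I_(dtgt y)) m (d : @hom Delta m (dsrc y)) : bounded j d ->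
    to_at X j d ∘ projr (to_obj X) x y
      = @to_at _ X (dsum x y) (rshift _ j) m (rinc _ _ ∘ d).
  by move=> bd; rewrite projrE; apply: to_muV_r.
have b0 : @bounded (conn n) ord0 n (idm (n : Delta)) := @bounded_conn _ _ _.
have b1 := @bounded_linc (conn n) r _ _ _ b0.
have b2 := @bounded_rinc l (dsum (conn n) r) _ _ _ b1.
rewrite /midproj -lock -[LHS]ccomp1m -[idm _](fmap1 X) -to_at_conn.
rewrite [LHS]ccompA L // [LHS]ccompA R // [LHS]to_at_map //.
apply: to_at_eq => //; rewrite /mid_map; congr (_ ∘ _).
by apply: omapP => c; apply: ord_inj.
Qed.

Lemma from_map_to (X : simplicial C) m n (d : @hom Delta m n) :
  from_map (to_obj X) d = fmap X (d : @hom (op Delta) n m).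
Proof.
rewrite /from_map to_midproj -to_at_conn; apply: to_at_eq; last exact: span_map.
exact: ord1.
Qed.

(** The equality is strict because [to_ob X (conn n)] computes to X_n, thanks to the form of
    [prodob]. *)
Lemma from_to_obj (X : simplicial C) : from_obj (to_obj X) = X.
Proof.
case: X => x xm x1 xM; apply: functor_map_eq => a b d.
exact: (@from_map_to (Functor x1 xM)).
Qed.

Lemma to_nt_conn (X Y : simplicial C) (s : @hom (simplicial C) X Y) n :
  to_nt_comp s (conn n) = nt s n.
Proof.
have b0 : @bounded (conn n) ord0 n (idm (n : Delta)) := @bounded_conn _ _ _.
have := to_at_nt s b0; rewrite !to_at_conn [fmap X _]fmap1 [fmap Y _]fmap1.
by rewrite ccomp1m ccompm1.
Qed.

Lemma unit_nt_conn (F : dmonfun C) n : unit_nt_comp F (conn n) = idm _.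
Proof.
have := @to_at_unit _ F (conn n) ord0 n (idm (n : Delta)).
rewrite !to_at_conn from_at_conn [fmap (from_obj F) _]fmap1 ccomp1m => ->.
exact: from_map_id.
Qed.

Lemma counit_conn (F : dmonfun C) n : counit_comp F (conn n) = idm _.
Proof.
by have := unitK F (conn n); rewrite unit_nt_conn [_ ∘ idm _]ccompm1.
Qed.

End ToFrom.

(** * The two functors and the natural isomorphisms *)

Section Equiv.
Variable C : cartesian.
Local Notation N := (cart_monoidal C).

Lemma to_mor1 (X : simplicial C) : to_mor (idm X) = idm (to_obj X).
Proof.
apply: monnattrans_eq => a; apply: to_at_ext => i.
by rewrite [LHS]to_at_nt ?[LHS]ccomp1m ?[RHS]ccompm1 //; apply: bounded_incl.
Qed.

Lemma to_morM (X Y Z : simplicial C) (t : hom Y Z) (s : hom X Y) :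
  to_mor (t ∘ s) = to_mor t ∘ to_mor s.
Proof.
apply: monnattrans_eq => a; apply: to_at_ext => i; have bi := @bounded_incl _ i.
by rewrite [LHS]to_at_nt // [RHS]to_at_ntA // to_at_nt // ccompA.
Qed.

Definition to_functor : functor (simplicial C) (dmonfun C) :=
  @Functor (simplicial C) (dmonfun C) (@to_obj C) (@to_mor C) to_mor1 to_morM.

Definition from_functor : functor (dmonfun C) (simplicial C).
Proof.
refine (@Functor (dmonfun C) (simplicial C) (@from_obj C) (@from_mor C) _ _);
  by move=> *; apply: nattrans_eq.
Defined.

Lemma strict_fwd_nat (X : simplicial C) m n (d : @hom (op Delta) m n) :
  idm (fob X n) ∘ fmap X d = fmap (from_obj (to_obj X)) d ∘ idm (fob X m).
Proof. by rewrite ccomp1m ccompm1 [RHS]from_map_to. Qed.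

Lemma strict_bwd_nat (X : simplicial C) m n (d : @hom (op Delta) m n) :
  idm (fob X n) ∘ fmap (from_obj (to_obj X)) d = fmap X d ∘ idm (fob X m).
Proof. by rewrite ccomp1m ccompm1 [LHS]from_map_to. Qed.

(** Objects agree by computation, so identities serve as components and no transport along
    [from_to_obj] appears. *)
Definition strict_fwd (X : simplicial C) : nattrans X (from_obj (to_obj X)) :=
  @Nattrans (op Delta) C X (from_obj (to_obj X))
    (fun n => idm (fob X n)) (@strict_fwd_nat X).

Definition strict_bwd (X : simplicial C) : nattrans (from_obj (to_obj X)) X :=
  @Nattrans (op Delta) C (from_obj (to_obj X)) X
    (fun n => idm (fob X n)) (@strict_bwd_nat X).

Lemma strict_fwdP (X Y : simplicial C) (s : hom X Y) :
  (strict_fwd Y : @hom (simplicial C) _ _) ∘ s = from_mor (to_mor s) ∘ strict_fwd X.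
Proof.
by apply: nattrans_eq => n; rewrite [LHS]ccomp1m [RHS]ccompm1 [RHS]to_nt_conn.
Qed.

Lemma strict_bwdP (X Y : simplicial C) (s : hom X Y) :
  (strict_bwd Y : @hom (simplicial C) _ _) ∘ from_mor (to_mor s) = s ∘ strict_bwd X.
Proof.
by apply: nattrans_eq => n; rewrite [LHS]ccomp1m [RHS]ccompm1 [LHS]to_nt_conn.
Qed.

Definition from_to_iso : @iso (fun_cat (simplicial C) (simplicial C))
  (fid _) (fcomp from_functor to_functor).
Proof.
refine (@Iso (fun_cat (simplicial C) (simplicial C))
  (fid _) (fcomp from_functor to_functor)
  (@Nattrans _ _ (fid _) (fcomp from_functor to_functor) strict_fwd strict_fwdP)
  (@Nattrans _ _ (fcomp from_functor to_functor) (fid _) strict_bwd strict_bwdP) _ _);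
  by apply: nattrans_eq => X; apply: nattrans_eq => n; apply: ccomp1m.
Defined.

Definition unit_iso (F : dmonfun C) : @iso (dmonfun C) F (to_obj (from_obj F)) :=
  @inverse_iso Dmon N F (to_obj (from_obj F)) (unit_mor F)
    (@counit_comp C F) (@unitK C F) (@counitK C F).

Lemma unit_nat (F G : dmonfun C) (t : hom F G) :
  fwd (unit_iso G) ∘ t = to_mor (from_mor t) ∘ fwd (unit_iso F).
Proof.
apply: monnattrans_eq => a; apply: to_proj_ext => i.
rewrite [LHS]ccompA to_proj_unit [LHS]piece_nt.
rewrite -to_at_incl [RHS]to_at_ntA; last exact: bounded_incl.
by rewrite to_at_incl; congr (_ ∘ _); rewrite [RHS]to_proj_unit.
Qed.

Lemma counit_nat (F G : dmonfun C) (t : hom F G) :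
  bwd (unit_iso G) ∘ to_mor (from_mor t) = t ∘ bwd (unit_iso F).
Proof.
rewrite -[LHS]ccompm1 -(bwdK (unit_iso F)) -ccompA (ccompA (to_mor _)) -unit_nat.
by rewrite !ccompA fwdK ccomp1m.
Qed.

Definition to_from_iso : @iso (fun_cat (dmonfun C) (dmonfun C))
  (fcomp to_functor from_functor) (fid _).
Proof.
refine (@Iso (fun_cat (dmonfun C) (dmonfun C))
  (fcomp to_functor from_functor) (fid _)
  (@Nattrans _ _ (fcomp to_functor from_functor) (fid _)
     (fun F => bwd (unit_iso F)) counit_nat)
  (@Nattrans _ _ (fid _) (fcomp to_functor from_functor)
     (fun F => fwd (unit_iso F)) unit_nat) _ _).
- by apply: nattrans_eq => F; apply: bwdK.
- by apply: nattrans_eq => F; apply: fwdK.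
Defined.

Definition simplicial_equiv : equivalence (simplicial C) (dmonfun C) :=
  Equivalence from_to_iso to_from_iso.

Lemma agree_from_obj (F : dmonfun C) : agree (from_obj F) F.
Proof. by apply: functor_map_eq => m n g; apply: from_map_pre. Qed.

(** The decomposition turns the i-th coordinate into [piece F i], and [phi a] is the identity on
    sources, so it leaves the inert inclusion in place. Condition (b) follows when the transports
    are identities. *)
Lemma phi_map_at X (F : dmonfun C) (e : agree X F) (a : dob) i :
  bigproj _ i ∘ phi_map e a
  = agree_from e (fibre a i) ∘ (from_map F (inert_incl i) ∘ agree_to e (dsrc a)).
Proof.
rewrite /phi_map [LHS]ccompA bigprojP -[LHS]ccompA; congr (_ ∘ _).
rewrite [LHS]ccompA; congr (_ ∘ _).
rewrite [LHS]ccompA [bigproj _ _ ∘ _]decomp_piece -from_at_incl.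
rewrite [LHS]from_at_map; last exact: bounded_incl.
rewrite -from_at_conn; apply: from_at_eq; first by rewrite [LHS]ord1.
by rewrite pre_id ccomp1m.
Qed.

Lemma agree_to_id (F : dmonfun C) (e : agree (from_obj F) F) n : agree_to e n = idm _.
Proof. exact: eq_hom_id. Qed.

Lemma agree_from_id (F : dmonfun C) (e : agree (from_obj F) F) n : agree_from e n = idm _.
Proof. exact: eq_hom_id. Qed.

Lemma correspond_from (F : dmonfun C) : correspond (from_obj F) F.
Proof.
exists (agree_from_obj F) => a.
have H i : bigproj _ i ∘ phi_map (agree_from_obj F) a
    = fmap (from_obj F) (inert_incl i).
  by rewrite phi_map_at agree_from_id agree_to_id ccompm1 [LHS]ccomp1m.
split=> [|i]; last by rewrite H.
by apply: (@bigproj_ext C) => i; rewrite H bigprojP.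
Qed.

Lemma agree_toK X (F : dmonfun C) (e : agree X F) n :
  agree_to e n ∘ agree_from e n = idm _.
Proof. by rewrite /agree_to /agree_from [LHS]eq_hom_trans; apply: eq_hom_id. Qed.

(* Every map of Delta factors as an active map, an inert inclusion and an
   active map; agreement settles the active factors and condition (b) the
   inert one. *)
Lemma correspond_nat X (F : dmonfun C) (e : agree X F) (h : inert_condition e)
    m n (d : @hom Delta m n) :
  from_map F d ∘ agree_to e n = agree_to e m ∘ fmap X (d : @hom (op Delta) n m).
Proof.
have act p q (g : omap p q) : from_map F (pre g) ∘ agree_to e p
    = agree_to e q ∘ fmap X (pre g : @hom (op Delta) p q).
  by rewrite from_map_pre; apply: (eq_functor_nat e).
have inc (a : dob) (i : 'I_(dtgt a)) : from_map F (inert_incl i) ∘ agree_to e _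
    = agree_to e _ ∘ fmap X (inert_incl i : @hom (op Delta) _ _).
  have [_ ->] := h a; rewrite phi_map_at ccompA.
  by rewrite agree_toK ccomp1m.
pose b := dsum (conn 1) (dsum (conn m) (conn 1)).
pose i : 'I_(dtgt b) := rshift 1 (lshift 1 ord0).
have mE : fibre b i = m by rewrite fibre_dsumr fibre_dsuml fibre_conn.
(* The dual of [span d] is the first active factor; the middle fibre starts at position 1, just
   after the new bottom. The other active factor is the cast along [mE], written as a dual so that
   agreement covers it. *)
have dE : d = pre (dfst (span d)) ∘ (inert_incl i ∘ pre (ocast mE)).
  rewrite -[LHS]span_map /mid_map; congr (_ ∘ _); apply: omapP => c; apply: ord_inj.
  rewrite [RHS]inert_inclE pre_castE.
  have -> : oadj (darr b) i = 1.
    by rewrite /= oadj_osum_r oadj0.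
  by [].
have fX : fmap X (d : @hom (op Delta) n m)
    = fmap X (pre (ocast mE) : @hom (op Delta) _ _) ∘
      (fmap X (inert_incl i : @hom (op Delta) _ _) ∘
       fmap X (pre (dfst (span d)) : @hom (op Delta) _ _)).
  by rewrite -!fmapM [in LHS]dE; congr (fmap X _); rewrite /= -ocompA.
rewrite fX [in LHS]dE 2!from_map_comp -!ccompA act.
rewrite (ccompA (from_map F (inert_incl i))) inc.
by rewrite -ccompA (ccompA (from_map F _)) act -!ccompA.
Qed.

(** Agreement gives the equality of objects, and [correspond_nat] the compatibility of its
    transports with all maps of Delta. *)
Lemma correspond_unique X (F : dmonfun C) : correspond X F -> X = from_obj F.
Proof.
case=> e h.
have e0 : fob X = fob (from_obj F) := congr1 (@fob _ _) e.
apply: (eq_functor (e := e0)) => a b d.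
have := correspond_nat h d; rewrite /agree_to.
rewrite (eq_hom_irr _ (congr1 (fun h => h a) e0)).
by rewrite (eq_hom_irr _ (congr1 (fun h => h b) e0)).
Qed.

Lemma correspond_to (X : simplicial C) : correspond X (to_obj X).
Proof. by rewrite -[X in correspond X _]from_to_obj; apply: correspond_from. Qed.

(** Transformations commute with the pieces, which are jointly monic and end in connected
    objects. *)
Lemma dmonfun_hom_ext (F G : dmonfun C) (s t : hom F G) :
  (forall n, mnt s (conn n) = mnt t (conn n)) -> s = t.
Proof.
move=> e; apply: monnattrans_eq => a; apply: piece_ext => i.
by rewrite !piece_nt e.
Qed.

Lemma mnt_eq_hom (X Y : simplicial C) (e : X = Y) n :
  mnt (eq_hom (congr1 (@to_obj C) e) : monnattrans _ _) (conn n)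
  = eq_hom (congr1 (fun Z : simplicial C => fob Z n) e).
Proof. by case: Y / e. Qed.

End Equiv.

(** * Uniqueness up to a unique compatible isomorphism *)

Lemma correspond_iso (C : cartesian) (X : simplicial C) (F G : dmonfun C) :
  correspond X F -> correspond X G ->
  exists! t : iso F G, correspond_hom (idm X) (fwd t).
Proof.
move=> XF XG; have [eF _] := XF; have [eG _] := XG.
have eFG : from_obj F = from_obj G.
  by rewrite -(correspond_unique XF) (correspond_unique XG).
(* X equals both [from_obj F] and [from_obj G], so the units compare F and G with one monoidal
   functor, up to transport. *)
pose f : hom F G :=
  bwd (unit_iso G) ∘ (eq_hom (congr1 (@to_obj C) eFG) ∘ fwd (unit_iso F)).
pose g : hom G F :=
  bwd (unit_iso F) ∘ (eq_hom (esym (congr1 (@to_obj C) eFG)) ∘ fwd (unit_iso G)).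
have gf : g ∘ f = idm F.
  rewrite /g /f -!ccompA (ccompA (fwd _)) bwdK ccomp1m (ccompA (eq_hom _)).
  by rewrite eq_homK ccomp1m fwdK.
have fg : f ∘ g = idm G.
  rewrite /g /f -!ccompA (ccompA (fwd _)) bwdK ccomp1m (ccompA (eq_hom _)).
  by rewrite eq_homVK ccomp1m fwdK.
(* On connected objects the unit and its inverse are identities, so f is there the transport along
   [eFG]. *)
have fE n : mnt f (conn n) ∘ agree_to eF n = agree_to eG n.
  have -> : mnt f (conn n) = eq_hom (congr1 (fun Z : simplicial C => fob Z n) eFG).
    rewrite -mnt_eq_hom -[RHS]ccomp1m -(counit_conn G n) -[RHS]ccompm1.
    by rewrite -(unit_nt_conn F n) -ccompA.
  by rewrite /agree_to [LHS]eq_hom_trans; apply: eq_hom_irr.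
exists (Iso gf fg); split; first by exists eF, eG => n; rewrite ccompm1 fE.
(* Compatibility fixes t on connected objects, since [agree_to] is invertible, and those values
   determine t. *)
move=> t [eF' [eG' ht]]; apply: iso_eq; apply: dmonfun_hom_ext => n.
rewrite (proof_irrelevance _ eF' eF) (proof_irrelevance _ eG' eG) in ht.
rewrite -[LHS]ccompm1 -[RHS]ccompm1 -(agree_toK eF n) [LHS]ccompA [RHS]ccompA.
by rewrite fE ht ccompm1.
Qed.

Theorem proposition6p6 (C : cartesian) :
  exists E : equivalence (simplicial C) (dmonfun C),
    (forall X : simplicial C, correspond X (fob (eqv_to E) X)) /\
    (forall Xb : dmonfun C, correspond (fob (eqv_from E) Xb) Xb) /\
    (forall (X Y : simplicial C) (s : hom X Y),
       correspond_hom s (fmap (eqv_to E) s)) /\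
    (forall (Xb Yb : dmonfun C) (t : hom Xb Yb),
       correspond_hom (fmap (eqv_from E) t) t) /\
    (forall (X X' : simplicial C) (Xb : dmonfun C),
       correspond X Xb -> correspond X' Xb -> X = X') /\
    (forall (X : simplicial C) (Xb Xb' : dmonfun C),
       correspond X Xb -> correspond X Xb' ->
       exists! t : iso Xb Xb', correspond_hom (idm X) (fwd t)).
Proof.
exists (simplicial_equiv C); split; first exact: correspond_to.
split; first exact: correspond_from.
split.
  move=> X Y s; have [e _] := correspond_to X; have [e' _] := correspond_to Y.
  exists e, e' => n; rewrite [mnt _ _]to_nt_conn.
  (* Both agreements equate an object with itself by computation, so their transports are
     identities. *)
  by rewrite [agree_to e n]eq_hom_id [agree_to e' n]eq_hom_id [LHS]ccompm1 [RHS]ccomp1m.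
split.
  move=> F G t; exists (agree_from_obj F), (agree_from_obj G) => n.
  by rewrite !agree_to_id [LHS]ccompm1 [RHS]ccomp1m.
split=> [X X' F XF X'F|X F G]; last exact: correspond_iso.
by rewrite (correspond_unique XF) (correspond_unique X'F).
Qed.
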